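(* There are $k\in\mathbb{N}$ and a function $f\in O(\log n)$ such that for every $n\in\mathbb{N}$ and every interval graph $G$ of order $n$ there is a $\mathsf{C}^k$-sentence $\Phi^G$ over the vocabulary $\{E\}$ of quantifier depth at most $f(n)$ that describes $G$ up to isomorphism, i.e., for every graph $H$: $H\models\Phi^G$ iff $H\cong G$.
   Context: Graphs are $\{E\}$-structures with $E$ binary; undirected graphs have symmetric irreflexive $E$. An interval is a set of consecutive integers; for a finite set $\mathcal{I}$ of intervals, $G_{\mathcal{I}}$ is the graph with vertex set $\mathcal{I}$ in which distinct $I,J$ are adjacent iff $I\cap J\neq\emptyset$. An (undirected) graph is an interval graph if it is isomorphic to some $G_{\mathcal{I}}$. The order of a graph is its number of vertices. $\mathsf{C}$ is first-order logic extended by counting quantifiers $\exists^{\ge m}x\,\psi$ (''at least $m$ elements $x$ satisfy $\psi$'') for all $m\in\mathbb{N}$; $\mathsf{C}^k$ is its fragment using only the variables $x_1,\dots,x_k$ (reusable); quantifier depth is the maximal nesting depth of quantifiers. *)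

(* Defs.v *)
From mathcomp Require Import all_boot all_order all_algebra.
From mathcomp Require Import all_classical all_reals all_analysis.

Set Implicit Arguments.
Unset Strict Implicit.
Unset Printing Implicit Defensive.

Local Open Scope classical_set_scope.
Local Open Scope card_scope.

(* An arbitrary structure over one binary relation symbol: possibly infinite,
   empty, directed, or with loops. *)
Record graph := Graph { vertex :> Type; edge : vertex -> vertex -> Prop }.

Definition undirected (G : graph) : Prop :=
  (forall x y : G, edge x y -> edge y x) /\ (forall x : G, ~ edge x x).

Definition isomorphic (G H : graph) : Prop :=
  exists2 h : G -> H, bijective h & forall x y : G, edge x y <-> edge (h x) (h y).

Definition has_order (G : graph) (n : nat) : Prop := [set: G] #= `I_n.

Definition intersection_graph (I : set (set int)) : graph :=
  @Graph (set_type I)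
    (fun A B => A <> B /\ (set_val A `&` set_val B !=set0)).

(* [is_interval A] is order-convexity of A, that is, A consists of consecutive
   integers. Empty and unbounded intervals are allowed: in a finite family they
   can be replaced by nonempty bounded ones without changing the graph up to
   isomorphism. *)
Definition interval_graph (G : graph) : Prop :=
  undirected G /\
  exists I : set (set int),
    [/\ finite_set I, (forall A, I A -> is_interval A)
      & isomorphic G (intersection_graph I)].

(* C^k: the variables x_1, ..., x_k are the elements of 'I_k, and
   [FExGe m x p] says that at least m elements x satisfy p. *)
Inductive formula (k : nat) : Type :=
  | FEq of 'I_k & 'I_k
  | FEdge of 'I_k & 'I_k
  | FNot of formula k
  | FAnd of formula k & formula k
  | FOr of formula k & formula k
  | FEx of 'I_k & formula k
  | FAll of 'I_k & formula k
  | FExGe of nat & 'I_k & formula k.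

Fixpoint qdepth k (phi : formula k) : nat :=
  match phi with
  | FEq _ _ | FEdge _ _ => 0
  | FNot p => qdepth p
  | FAnd p q | FOr p q => maxn (qdepth p) (qdepth q)
  | FEx _ p | FAll _ p | FExGe _ _ p => (qdepth p).+1
  end.

Fixpoint free_vars k (phi : formula k) : {set 'I_k} :=
  match phi with
  | FEq x y | FEdge x y => [set x; y]%SET
  | FNot p => free_vars p
  | FAnd p q | FOr p q => free_vars p :|: free_vars q
  | FEx x p | FAll x p | FExGe _ x p => free_vars p :\ x
  end.

Definition sentence k (phi : formula k) : Prop := free_vars phi = finset.set0.

(* Assignments are partial so that sentences can be evaluated from the empty
   assignment even in the structure without vertices; a sentence never reads
   an unassigned variable. *)
Fixpoint sat (G : graph) k (v : 'I_k -> option G) (phi : formula k) : Prop :=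
  match phi with
  | FEq x y => exists a : G, v x = Some a /\ v y = Some a
  | FEdge x y => exists a b : G, [/\ v x = Some a, v y = Some b & edge a b]
  | FNot p => ~ sat v p
  | FAnd p q => sat v p /\ sat v q
  | FOr p q => sat v p \/ sat v q
  | FEx x p => exists a : G, sat [eta v with x |-> Some a] p
  | FAll x p => forall a : G, sat [eta v with x |-> Some a] p
  | FExGe m x p => `I_m #<= [set a : G | sat [eta v with x |-> Some a] p]
  end.

Definition models (G : graph) k (phi : formula k) : Prop :=
  sat (fun _ : 'I_k => None : option G) phi.

(* Main.v *)
(* Call x and y overlapping if they are adjacent and their closed neighbourhoods
   N[x], N[y] are incomparable. In every graph the connected components of the
   relation "overlapping or twins" form a forest under strict inclusion of
   closed neighbourhoods, and a vertex outside the subtree (the hull) of a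
   component is adjacent to all of the hull or to none of it. In an interval
   graph the non-adjacent pairs met by one component form, up to reversal, a
   single class of the relation "xy forces xy' if y and y' are adjacent". So one
   such pair orients the component as an interval order, whose edges can be read
   off from the numbers of predecessors and successors.
   Components and orientations are reachability relations, hence have counting
   formulas of logarithmic depth by path doubling. With these as atoms, a
   centroid argument on the forest (split a hull, or a hull with a smaller hull
   removed, at a component all of whose child pieces are at most half as big)
   shows that formulas of depth O(log n) determine G up to isomorphism: whenever
   H of order n agrees with G on them, isomorphisms of the pieces can be glued. *)
Require Import Defs.
From Stdlib Require List.
From mathcomp Require Import all_boot all_order all_algebra.
From mathcomp Require Import all_classical all_reals all_analysis.
From mathcomp Require Import zify.
Import numFieldNormedType.Exports.

Set Implicit Arguments.
Unset Strict Implicit.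
Unset Printing Implicit Defensive.

(** The graph [H] compared with [G] is not assumed to be an interval graph, so whatever is used
    about it must hold in every graph or be carried over from [G]. This is why [good] compares
    numbers instead of asking for an interval order: it can be transferred to [H]. No formula for
    the individual notions is written down. Two finite graphs with marked vertices are compared in
    the bijective pebble game, and each notion is shown to be invariant when enough rounds remain.
    The bijections of the game move single vertices and may scatter a component, so blocks are
    matched only by counting colours. The forest can be a long path, so recursion along its levels
    would cost linear depth. Cutting at a centroid avoids this but leaves a hole in the surrounding
    context. No piece may acquire a second hole; this confines the cut to components whose hull
    still contains the old hole, and it makes each halving cost two cuts. *)

Lemma fiber_bijection (T T' : finType) (C : eqType) (X : pred T) (X' : pred T')
    (f : T -> C) (g : T' -> C) (t0 : T) (t0' : T') :
  (forall c, #|[pred x | X x && (f x == c)]| = #|[pred y | X' y && (g y == c)]|) ->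
  exists s t,
    (forall x, X x -> [/\ X' (s x), g (s x) = f x & t (s x) = x]) /\
    (forall y, X' y -> [/\ X (t y), f (t y) = g y & s (t y) = y]).
Proof.
move=> fibE.
pose F c := enum [pred x | X x && (f x == c)].
pose G c := enum [pred y | X' y && (g y == c)].
have size_FG c : size (F c) = size (G c) by rewrite /F /G -!cardE fibE.
have memF x c : (x \in F c) = X x && (f x == c) by rewrite mem_enum !inE.
have memG y c : (y \in G c) = X' y && (g y == c) by rewrite mem_enum !inE.
pose s x := nth t0' (G (f x)) (index x (F (f x))).
pose t y := nth t0 (F (g y)) (index y (G (g y))).
exists s, t; split=> [x Xx|y Xy].
  have lt : index x (F (f x)) < size (G (f x)).
    by rewrite -size_FG index_mem memF Xx /=.
  have := mem_nth t0' lt; rewrite memG -/(s x) => /andP[X's /eqP gs].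
  split=> //; rewrite /t gs /s index_uniq ?enum_uniq // nth_index //.
  by rewrite memF Xx /=.
have lt : index y (G (g y)) < size (F (g y)).
  by rewrite size_FG index_mem memG Xy /=.
have := mem_nth t0 lt; rewrite memF -/(t y) => /andP[Xt /eqP ft].
split=> //; rewrite /s ft /t index_uniq ?enum_uniq // nth_index //.
by rewrite memG Xy /=.
Qed.

(** * Overlap components *)

Lemma connect_invariant (W : finType) (r : rel W) (P : W -> Prop) :
  (forall u v, r u v -> P u -> P v) ->
  forall u v, connect r u v -> P u -> P v.
Proof.
move=> rP u v /connectP[p]; elim: p u => [|w p IHp] u /=; first by move=> _ ->.
by case/andP=> /rP uw /IHp wv vE /uw; apply: wv.
Qed.

Section Overlap.
Variable T : finType.
Implicit Types (e : rel T) (a b o p q x y z : T).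

Definition cadj e x y := (x == y) || e x y.
Definition far e x y := ~~ cadj e x y.
Definition nsub e x y := [forall z, cadj e x z ==> cadj e y z].
(* Adjacent and either twins or with incomparable closed neighbourhoods. *)
Definition link e x y := cadj e x y && (nsub e x y == nsub e y x).
Definition comp e := connect (link e).
Definition below e x y := nsub e x y && ~~ comp e x y.
Definition hull e o z := [exists x, comp e o x && nsub e z x].
Definition inner e o z := hull e o z && ~~ comp e o z.

(* If [y] and [y'] are adjacent and [x] is far from both, then an interval order
   places [y] and [y'] on the same side of [x]. *)
Definition force e (u v : T * T) :=
  [&& far e u.1 u.2, far e v.1 v.2 &
      ((u.1 == v.1) && cadj e u.2 v.2) || ((u.2 == v.2) && cadj e u.1 v.1)].
Definition orient e a b x y := far e x y && connect (force e) (a, b) (x, y).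
Definition num_before e q a b z := #|[pred x | hull e q x && orient e a b x z]|.
Definition rank e q a b z :=
  #|[pred y | comp e q y && (num_before e q a b z <= num_before e q a b y)]|.
Definition num_after e q a b x := #|[pred z | comp e q z && orient e a b x z]|.
(* The seed [(a, b)] orients [comp e q], with [(b, a)] giving the reverse order;
   far pairs are recovered from numbers that do not mention the other vertex. *)
Definition good e q a b :=
  [forall z, forall x, (comp e q z && hull e q x) ==>
     (far e x z == (rank e q a b z <= num_after e q a b x)
                   || (rank e q b a z <= num_after e q b a x))].

Section Forest.
Variable e : rel T.
Hypothesis e_sym : symmetric e.
Local Notation N := (cadj e).
Local Notation sub := (nsub e).

Lemma cadj_sym : symmetric N.
Proof. by move=> x y; rewrite /cadj eq_sym e_sym. Qed.

Lemma cadjxx x : N x x. Proof. by rewrite /cadj eqxx. Qed.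

Lemma nsubP x y : reflect (forall z, N x z -> N y z) (sub x y).
Proof. exact: 'forall_implyP. Qed.

Lemma nsubxx x : sub x x. Proof. exact/nsubP. Qed.

Lemma nsub_trans y x z : sub x y -> sub y z -> sub x z.
Proof. by move=> /nsubP xy /nsubP yz; apply/nsubP=> t /xy /yz. Qed.

Lemma nsub_cadj x y : sub x y -> N x y.
Proof. by move/nsubP/(_ x (cadjxx x)); rewrite cadj_sym. Qed.

Lemma link_sym : symmetric (link e).
Proof. by move=> x y; rewrite /link cadj_sym [sub x y == _]eq_sym. Qed.

Lemma comp_sym x y : comp e x y = comp e y x.
Proof. exact: (sym_connect_sym link_sym). Qed.

Lemma compxx x : comp e x x. Proof. exact: connect0. Qed.

Lemma comp_trans y x z : comp e x y -> comp e y z -> comp e x z.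
Proof. exact: connect_trans. Qed.

Lemma comp_eqr q x y : comp e x y -> comp e q x = comp e q y.
Proof.
move=> xy; apply/idP/idP => [qx|qy]; first exact: comp_trans xy.
by apply: comp_trans qy _; rewrite comp_sym.
Qed.

Lemma comp_eql q x y : comp e x y -> comp e x q = comp e y q.
Proof. by move=> xy; rewrite ![comp e _ q]comp_sym (comp_eqr _ xy). Qed.

Lemma cadj_comp_or_below x y :
  N x y -> [|| comp e x y, below e x y | below e y x].
Proof.
move=> xy; rewrite /below [comp e y x]comp_sym.
case: (boolP (comp e x y)) => //= nxy; rewrite !andbT.
apply/contraR: nxy; rewrite negb_or => /andP[nxy nyx].
by apply: connect1; rewrite /link xy (negPf nxy) (negPf nyx).
Qed.

(** Suppose that N[z] lay inside N[y] for some y linked to x. Then N[x] lies in N[z] and so in N[y],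
    the link makes x and y twins, and z becomes a twin of x, contrary to [~~ comp e x z]. *)
Lemma below_comp x y z : below e x z -> comp e x y -> below e y z.
Proof.
move=> xz xy; apply: (connect_invariant (P := fun y => below e y z) _ xy xz).
move=> {xz}x {xy}y xy /andP[xz nxz].
have cxy : comp e x y by apply: connect1.
have /andP[Nxy /eqP Exy] := xy.
have nyz : ~~ comp e y z by rewrite -(comp_eql _ cxy).
have Nyz : N y z by rewrite cadj_sym; apply: (nsubP _ _ xz).
have := cadj_comp_or_below Nyz; rewrite (negPf nyz) /= => /orP[//|/andP[zy _]].
have yx : sub y x by rewrite -Exy; apply: nsub_trans zy.
case/negP: nxz; apply: connect1; rewrite /link (nsub_cadj xz) xz.
by rewrite (nsub_trans zy yx).
Qed.

Lemma hullxx o : hull e o o.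
Proof. by apply/existsP; exists o; rewrite compxx nsubxx. Qed.

Lemma comp_hull o z : comp e o z -> hull e o z.
Proof. by move=> oz; apply/existsP; exists z; rewrite oz nsubxx. Qed.

Lemma hull_trans o z y : hull e o z -> hull e z y -> hull e o y.
Proof.
move=> /existsP[x /andP[ox zx]] /existsP[u /andP[zu yu]].
have [czx|nzx] := boolP (comp e z x).
  apply/existsP; exists u; rewrite yu andbT.
  by rewrite (comp_eqr _ (_ : comp e u x)) // -(comp_eql _ zu).
have /andP[ux _] : below e u x by apply: below_comp zu; rewrite /below zx.
by apply/existsP; exists x; rewrite ox (nsub_trans yu).
Qed.

Lemma hull_comp o z y : comp e o z -> hull e o y = hull e z y.
Proof.
by move=> oz; apply/idP/idP; apply: hull_trans; apply: comp_hull; rewrite // comp_sym.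
Qed.

Lemma hull_compr o z y : comp e z y -> hull e o z = hull e o y.
Proof.
move=> zy; apply/idP/idP => h; apply: hull_trans h _; apply: comp_hull => //.
by rewrite comp_sym.
Qed.

Lemma inner_comp o z y : comp e o z -> inner e o y = inner e z y.
Proof. by move=> oz; rewrite /inner (hull_comp _ oz) (comp_eql _ oz). Qed.

Lemma inner_compr o z y : comp e z y -> inner e o z = inner e o y.
Proof. by move=> zy; rewrite /inner (hull_compr _ zy) (comp_eqr _ zy). Qed.

Lemma below_hull x y : below e x y -> hull e y x.
Proof. by case/andP=> xy _; apply/existsP; exists y; rewrite compxx. Qed.

(** Let x and y be the members of the two components with N[z] inside N[x] and N[y]. Then x lies in
    N[z], hence in N[y], and adjacent vertices share a component or lie one below the other. With
    [hull_antisym] this gives the forest. *)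
Lemma hull_meet a b z : hull e a z -> hull e b z -> hull e a b || hull e b a.
Proof.
move=> /existsP[x /andP[ax zx]] /existsP[y /andP[cby zy]].
have Nxy : N x y.
  by apply: (nsubP _ _ zx); apply: nsub_cadj.
rewrite (hull_comp _ ax) (hull_comp _ cby) (hull_compr _ cby) (hull_compr _ ax).
case/or3P: (cadj_comp_or_below Nxy) => [/comp_hull->//|/below_hull->|/below_hull->//].
exact: orbT.
Qed.

Lemma hull_antisym a b : hull e a b -> hull e b a -> comp e a b.
Proof.
move=> /existsP[x /andP[ax bx]] /existsP[y /andP[cby ay]].
apply: contraT => nab; case/negP: (nab).
have /andP[yx _] : below e y x.
  apply: (below_comp (x := b)) => //.
  by rewrite /below bx -(comp_eqr _ ax) comp_sym.
have /andP[xy _] : below e x y.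
  by apply: (below_comp (x := a)); rewrite // /below ay -(comp_eqr _ cby).
have cxy : comp e x y by apply: connect1; rewrite /link (nsub_cadj xy) xy yx.
by rewrite (comp_eql _ ax) (comp_eqr _ cby).
Qed.

(** A neighbour x of y is also adjacent to the member u of the component with N[y] inside N[u].
    Being outside the hull, x is not below u, so u is below x, and [below_comp] spreads this over
    the whole component. *)
Lemma cadj_out q x y : hull e q y -> ~~ hull e q x -> N x y = below e q x.
Proof.
move=> /existsP[u /andP[qu yu]] nqx; apply/idP/idP => [xy|qx].
  have Nux : N u x by apply: (nsubP _ _ yu); rewrite cadj_sym.
  have nux : ~~ comp e u x.
    by rewrite -(comp_eql _ qu); apply: contra nqx; apply: comp_hull.
  have := cadj_comp_or_below Nux; rewrite (negPf nux) /= => /orP[ux|xu].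
    by apply: below_comp ux _; rewrite comp_sym.
  by case/negP: nqx; rewrite (hull_comp _ qu) below_hull.
have /andP[ux _] := below_comp qx qu.
by rewrite cadj_sym; apply: nsub_cadj; apply: nsub_trans ux.
Qed.

Lemma out_neq q x y : hull e q y -> ~~ hull e q x -> x != y.
Proof. by move=> qy; apply: contraNneq => ->. Qed.

Lemma edge_out q x y : hull e q y -> ~~ hull e q x -> e x y = below e q x.
Proof.
move=> qy qx; rewrite -(cadj_out qy qx) /cadj.
by rewrite (negPf (out_neq qy qx)).
Qed.

Lemma edge_outE q x y : hull e q y -> ~~ hull e q x -> e x y = e x q.
Proof. by move=> qy qx; rewrite !(@edge_out q) ?hullxx. Qed.

Lemma hull_disjoint_edge a b x y :
  hull e a x -> hull e b y -> ~~ hull e a b -> ~~ hull e b a -> e x y = false.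
Proof.
move=> ax cby nab nba.
have nbx : ~~ hull e b x.
  by apply/negP=> bx; have := hull_meet ax bx; rewrite (negPf nab) (negPf nba).
rewrite (edge_out cby nbx); apply/negP => /below_hull xb.
by case/negP: nab; apply: hull_trans xb.
Qed.

Lemma force_sym : symmetric (force e).
Proof.
move=> u v; rewrite /force andbCA ![v.1 == _]eq_sym ![v.2 == _]eq_sym.
by rewrite ![N _ v.2]cadj_sym ![N _ v.1]cadj_sym.
Qed.

Lemma orient_eqr a b x y z :
  cadj e x y -> far e x z -> far e y z -> orient e a b x z = orient e a b y z.
Proof.
move=> xy xz yz; rewrite /orient xz yz /=.
have xyz : connect (force e) (x, z) (y, z).
  by apply: connect1; rewrite /force /= xz yz eqxx xy orbT.
apply/idP/idP => /connect_trans; apply=> //.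
by rewrite (sym_connect_sym force_sym).
Qed.

(** This makes the counts labels of a whole child component. A member z of [comp e q] lies outside
    the hull of x, so it is adjacent to all of the component of x or to none of it, and in the
    second case the orientations towards z force each other. *)
Lemma num_after_comp q a b x y :
  comp e x y -> inner e q x -> num_after e q a b x = num_after e q a b y.
Proof.
move=> xy qx.
pose P y := comp e x y /\ num_after e q a b x = num_after e q a b y.
suff: P y by case.
apply: (connect_invariant (P := P) _ xy); last by split; rewrite ?compxx.
move=> u v uv [xu Exu].
have xv : comp e x v by rewrite -(comp_eqr _ (connect1 uv)).
split=> //; rewrite Exu; apply: eq_card => z; rewrite !inE.
have [qz|//] := boolP (comp e q z); rewrite /=.
have /andP[Nuv _] := uv.
have nxz : ~~ hull e x z.
  have /andP[hqx nqx] := qx; apply: contra nqx => xz.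
  by apply: hull_antisym => //; rewrite (hull_compr _ qz).
have Nz w : comp e x w -> cadj e w z = below e x z.
  by move=> /comp_hull xw; rewrite cadj_sym; apply: cadj_out nxz.
have [xz|xz] := boolP (below e x z).
  by rewrite /orient /far !Nz ?xz.
by apply: orient_eqr; rewrite // /far Nz.
Qed.

End Forest.
End Overlap.

(** * Interval orders *)

Section IntervalOrder.
Variables (T : finType) (e : rel T).
Implicit Types (lt : rel T) (a b o p q x y z : T).

(** The second clause excludes 2+2, which is Fishburn's condition for interval orders; with
    irreflexivity it also yields transitivity. *)
Definition interval_order_of lt :=
  [/\ irreflexive lt,
      forall x y x' y', lt x y -> lt x' y' -> lt x y' || lt x' y
    & forall x y, far e x y = lt x y || lt y x].

Lemma interval_order_converse lt :
  interval_order_of lt -> interval_order_of (fun x y => lt y x).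
Proof.
case=> irr fer farE; split=> [x|x y x' y'|x y]; rewrite ?irr //.
  by move=> h h'; rewrite fer.
by rewrite orbC farE.
Qed.

Hypothesis e_sym : symmetric e.
Variable lt : rel T.
Hypothesis ltP : interval_order_of lt.
Local Notation N := (cadj e).
Local Notation sub := (nsub e).

Let lt_irr : irreflexive lt. Proof. by case: ltP. Qed.
Let lt_ferrers x y x' y' : lt x y -> lt x' y' -> lt x y' || lt x' y.
Proof. by case: ltP => _ + _; apply. Qed.
Let farE x y : far e x y = lt x y || lt y x. Proof. by case: ltP. Qed.

Let lt_trans y x z : lt x y -> lt y z -> lt x z.
Proof. by move=> xy yz; have := lt_ferrers xy yz; rewrite lt_irr orbF. Qed.

Let lt_asym x y : lt x y -> lt y x = false.
Proof. by move=> xy; apply/negP => /(lt_trans xy); rewrite lt_irr. Qed.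

Let far_sym x y : far e x y = far e y x.
Proof. by rewrite !farE orbC. Qed.

Let lt_far x y : lt x y -> far e x y. Proof. by rewrite farE => ->. Qed.

Lemma lt_force x y y' : lt x y -> far e x y' -> N y y' -> lt x y'.
Proof.
move=> xy; rewrite farE => /orP[//|y'x] yy'.
by have := lt_far (lt_trans y'x xy); rewrite /far cadj_sym // yy'.
Qed.

Lemma force_lt u v : force e u v -> lt u.1 u.2 -> lt v.1 v.2.
Proof.
case: u v => [x y] [x' y'] /and3P[/= xy xy' /orP[]] /andP[/eqP E adj]; move: xy xy'.
  by rewrite E => _ xy' h; apply: lt_force adj.
rewrite E => _; rewrite farE => /orP[//|y'x'] xy'.
have := lt_force y'x' _ (_ : N x' x); rewrite cadj_sym // => /(_ _ adj).
by rewrite (far_sym y' x) lt_far // => /(_ isT) /lt_asym; rewrite xy'.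
Qed.

Lemma orient_lt a b x z : lt a b -> orient e a b x z -> lt x z.
Proof.
move=> ab /andP[_ h].
exact: (connect_invariant (P := fun u => lt u.1 u.2) force_lt h ab).
Qed.

(* Forcing on unordered far pairs: each pair is read in its [lt]-direction. *)
Definition directed (u : T * T) := if lt u.1 u.2 then u else (u.2, u.1).
Definition linked u v := connect (force e) (directed u) (directed v).

Lemma linked_trans v u w : linked u v -> linked v w -> linked u w.
Proof. exact: connect_trans. Qed.

Lemma linked_swap x y : far e x y -> linked (x, y) (y, x).
Proof.
by rewrite farE /linked /directed /= => /orP[] h; rewrite h (lt_asym h) connect0.
Qed.

Lemma linked_r x y y' : far e x y -> far e x y' -> N y y' -> linked (x, y) (x, y').
Proof.
move=> xy xy' yy'; rewrite /linked /directed /=; apply: connect1.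
move: (xy); rewrite farE => /orP[h|h].
  by rewrite h (lt_force h xy' yy') /force /= xy xy' yy' eqxx.
have [h'|_] := boolP (lt x y').
  by move: h; rewrite (lt_asym (lt_force h' xy _)) // cadj_sym.
by rewrite (lt_asym h) /force /= ![far e _ x]far_sym xy xy' yy' eqxx orbT.
Qed.

Lemma linked_l x x' y : far e x y -> far e x' y -> N x x' -> linked (x, y) (x', y).
Proof.
move=> xy x'y xx'; apply: linked_trans (linked_swap xy) _.
apply: linked_trans (linked_r (_ : far e y x) (_ : far e y x') xx') (linked_swap _);
  by rewrite far_sym.
Qed.

Let adj_lt x y : N x y -> (lt x y = false) * (lt y x = false).
Proof.
move=> xy; have : ~~ (lt x y || lt y x) by rewrite -farE /far xy.
by case/norP=> /negPf-> /negPf->.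
Qed.

(** Otherwise u, x, y, v would be an induced 4-cycle, and its two far pairs would form a forbidden
    2+2. *)
Lemma no_square u x y v :
  N u x -> N x y -> N y v -> far e u y -> far e x v -> far e u v.
Proof.
move=> ux xy yv; rewrite !farE => /orP[uy|yu] /orP[xv|vx].
- by have := lt_ferrers uy xv; rewrite (adj_lt xy) orbF => ->.
- by have := lt_ferrers uy vx; rewrite (adj_lt ux) (adj_lt yv).
- by have := lt_ferrers yu xv; rewrite (adj_lt ux) (adj_lt yv).
- by have := lt_ferrers yu vx; rewrite (adj_lt xy) /= => ->; rewrite orbT.
Qed.

Definition overlaps x y := [&& N x y, ~~ sub x y & ~~ sub y x].

Lemma overlaps_sym x y : overlaps x y = overlaps y x.
Proof. by rewrite /overlaps cadj_sym // [~~ _ && _]andbC. Qed.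

Lemma link_overlaps x y : link e x y -> overlaps x y || (sub x y && sub y x).
Proof. by rewrite /link /overlaps => /andP[-> /eqP->]; case: (sub y x). Qed.

Lemma nsubPn x y : ~~ sub x y -> exists2 u, N x u & far e y u.
Proof.
rewrite negb_forall => /existsP[u]; rewrite negb_imply => /andP[xu yu].
by exists u.
Qed.

(* The two ends of an overlapping pair [x], [y] determine a single class of far
   pairs, and [seed] belongs to it. *)
Definition guided seed x y :=
  (forall u, N x u -> far e u y -> linked seed (u, y)) /\
  (forall v, N y v -> far e x v -> linked seed (x, v)).

Section Seed.
Variable seed : T * T.

(** On a path u, x, y, v the pairs (u, y), (u, v), (x, v) are far and successively linked. So one
    pair at the end of x fixes all pairs at the end of y, and these in turn fix the remaining pairs
    at the end of x. *)
Lemma guided_left x y u :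
  overlaps x y -> N x u -> far e u y -> linked seed (u, y) -> guided seed x y.
Proof.
move=> /and3P[xy _ yx] xu uy s.
have right v : N y v -> far e x v -> linked seed (x, v).
  move=> yv xv; have uv : far e u v.
    by apply: no_square xy yv uy xv; rewrite cadj_sym.
  apply: linked_trans s _; apply: linked_trans (linked_r uy uv yv) _.
  by apply: linked_l; rewrite // cadj_sym.
split=> // u' xu' u'y.
have [v yv xv] := nsubPn yx.
have u'v : far e u' v by apply: no_square xy yv u'y xv; rewrite cadj_sym.
apply: linked_trans (right _ yv xv) _; apply: linked_trans (linked_l xv u'v xu') _.
by apply: linked_r; rewrite // cadj_sym.
Qed.

Lemma guided_sym x y : guided seed x y -> guided seed y x.
Proof.
have sw u v : far e u v -> linked seed (u, v) -> linked seed (v, u).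
  by move=> uv /linked_trans; apply; apply: linked_swap.
case=> l r; split=> u Nu; rewrite far_sym => fu.
  exact: sw (fu) (r _ Nu fu).
exact: sw (fu) (l _ Nu fu).
Qed.

Lemma guided_right x y v :
  overlaps x y -> N y v -> far e x v -> linked seed (x, v) -> guided seed x y.
Proof.
move=> xy yv xv s; apply/guided_sym; apply: (guided_left (u := v)) => //.
- by rewrite overlaps_sym.
- by rewrite far_sym.
- by apply: linked_trans s (linked_swap xv).
Qed.

(** If x is far from z, then x itself is a neighbour of y that starts [guided_left]. Otherwise take
    v next to x and w next to z, both far from y; the pair (v, y) then has to be linked to (w,
    y). *)
Lemma guided_step x y z :
  overlaps x y -> guided seed x y -> overlaps y z -> guided seed y z.
Proof.
move=> oxy gxy oyz; have /and3P[xy nxy _] := oxy; have /and3P[yz _ nzy] := oyz.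
have [xz|fxz] := boolP (N x z); last first.
  by apply: (guided_left (u := x)); rewrite // 1?cadj_sym //; apply: gxy.2.
have [v xv yv] := nsubPn nxy; have [w zw yw] := nsubPn nzy.
have sv : linked seed (v, y) by apply: gxy.1; rewrite // far_sym.
suff : linked seed (w, y).
  move=> sw; apply: (guided_right (v := w)) => //.
  by apply: linked_trans sw (linked_swap _); rewrite far_sym.
have [vw|fvw] := boolP (N v w).
  by apply: linked_trans sv (linked_l _ _ vw); rewrite far_sym.
have [zv|fzv] := boolP (N z v).
  have : linked seed (y, v).
    by apply: linked_trans sv (linked_swap _); rewrite far_sym.
  move/(guided_right oyz zv yv) => g; have := g.2 _ zw yw.
  by move/linked_trans; apply; apply: linked_swap.
have [xw|fxw] := boolP (N x w).
  by apply: gxy.1; rewrite // far_sym.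
(* Now v, x, z, w is an induced path, and the chain is (v, y), (v, z), (v, w), (x, w), (y, w). *)
apply: linked_trans sv _.
apply: linked_trans (linked_r (_ : far e v y) (_ : far e v z) yz) _.
- by rewrite far_sym.
- by rewrite far_sym.
apply: linked_trans (linked_r _ fvw zw) _; first by rewrite far_sym.
apply: linked_trans (linked_l fvw fxw _) _; first by rewrite cadj_sym.
apply: linked_trans (linked_l fxw yw xy) _.
exact: linked_swap.
Qed.

Lemma guided_comp x0 y0 y z :
  overlaps x0 y0 -> guided seed x0 y0 -> comp e x0 y -> overlaps y z ->
  guided seed y z.
Proof.
move=> oxy gxy; move=> h; move: z.
apply: (connect_invariant (P := fun y => forall z, overlaps y z -> guided seed y z) _ h).
  move=> {h}y y' /link_overlaps /orP[yy' IH z oz|/andP[yy' y'y] IH z oz].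
    exact: guided_step (IH _ yy') oz.
  have oyz : overlaps y z.
    have /and3P[y'z ny'z nzy'] := oz; rewrite /overlaps (nsubP _ _ _ y'y) //=.
    apply/andP; split; first by apply: contra ny'z; apply: nsub_trans.
    by apply: contra nzy' => /nsub_trans; apply.
  have [u y'u zu] : exists2 u, N y' u & far e z u by apply: nsubPn; case/and3P: oz.
  apply: (guided_left (u := u)) => //; first by rewrite far_sym.
  by apply: (IH z oyz).1 (nsubP _ _ _ y'y _ y'u) _; rewrite far_sym.
by move=> z; apply: guided_step (guided_sym gxy); rewrite overlaps_sym.
Qed.

(** Walk through the component from a member t with N[x] inside N[t], which is adjacent to x. Where
    the walk leaves N[x] along a link z z', these two are not twins, so they overlap and (x, z') is
    one of their guided pairs. Between members far from x, consecutive pairs force each other. *)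
Lemma linked_hull q x0 y0 x z :
  overlaps x0 y0 -> guided seed x0 y0 -> comp e q x0 ->
  hull e q x -> comp e q z -> far e x z -> linked seed (x, z).
Proof.
move=> oxy gxy qx0 /existsP[t /andP[qt xt]] qz.
have tz : comp e t z by rewrite -(comp_eql _ _ qt).
pose P z := comp e q z /\ (far e x z -> linked seed (x, z)).
suff: P z by case.
apply: (connect_invariant (P := P) _ tz); last first.
  by split=> //; rewrite /far nsub_cadj.
move=> {qz tz}z z' zz' [qz IH].
have qz' : comp e q z' by rewrite -(comp_eqr e_sym _ (connect1 zz')).
split=> // xz'.
have /andP[Nzz' _] := zz'.
have [xz|fxz] := boolP (N x z); last first.
  exact: linked_trans (IH fxz) (linked_r fxz xz' Nzz').
have ozz' : overlaps z z'.
  case/orP: (link_overlaps zz') => // /andP[/nsubP/(_ x)].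
  by rewrite cadj_sym // => /(_ xz); rewrite cadj_sym // (negPf xz').
have g := guided_comp oxy gxy (_ : comp e x0 z) ozz'.
by apply: (g _).1; rewrite // 1?cadj_sym // -(comp_eql e_sym _ qx0).
Qed.
End Seed.

End IntervalOrder.

Lemma orient_swap (T : finType) (e : rel T) a b x y :
  symmetric e -> orient e a b x y = orient e b a y x.
Proof.
move=> e_sym; pose sw (u : T * T) := (u.2, u.1).
have sw_force u v : force e u v -> force e (sw u) (sw v).
  rewrite /force /far /= ![cadj e _.2 _.1]cadj_sym //.
  by case/and3P=> -> ->; rewrite orbC.
have sw_conn u v : connect (force e) u v -> connect (force e) (sw u) (sw v).
  move=> uv; apply: (connect_invariant (P := fun v => connect (force e) (sw u) (sw v)) _ uv (connect0 _ _)).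
  by move=> w w' /sw_force ww' /connect_trans; apply; apply: connect1.
rewrite /orient /far [cadj e y x]cadj_sym //; congr (_ && _).
by apply/idP/idP; apply: sw_conn.
Qed.

(** * Reading an interval order off counts *)

Section GoodSeed.
Variables (T : finType) (e : rel T).
Hypothesis e_sym : symmetric e.

(** Predecessor sets are nested, so the successors of x in the component form an upper set with
    respect to [num_before]. Such a set contains z exactly when it is at least as large as the upper
    set generated by z, whose size is the rank. *)
Lemma rank_num_after lt q a b x z :
  interval_order_of e lt ->
  (forall x z, hull e q x -> comp e q z -> orient e a b x z = lt x z) ->
  hull e q x -> comp e q z -> orient e a b x z = (rank e q a b z <= num_after e q a b x).
Proof.
move=> ltP orE qx qz.
have nested y z' : comp e q y -> comp e q z' -> hull e q x ->
    orient e a b x y -> num_before e q a b y <= num_before e q a b z' -> orient e a b x z'.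
  move=> qy qz' hx xy; rewrite leqNgt => le; apply: contraR le => nxz'.
  apply: proper_card; apply/properP; split; last first.
    by exists x; rewrite !inE hx //= (negPf nxz').
  apply/fintype.subsetP => x'; rewrite !inE => /andP[qx']; rewrite qx' !orE //= => x'z'.
  move: xy nxz'; rewrite !orE // => xy nxz'.
  by case: ltP => _ /(_ _ _ _ _ xy x'z'); rewrite (negPf nxz').
apply/idP/idP => [xz|].
  apply: subset_leq_card; apply/fintype.subsetP => y; rewrite !inE => /andP[qy le].
  by rewrite qy (nested z).
apply: contraLR => nxz; rewrite -ltnNge; apply: proper_card; apply/properP; split.
  apply/fintype.subsetP => y; rewrite !inE => /andP[qy xy]; rewrite qy /=.
  by apply: contraR nxz; rewrite -ltnNge => /ltnW; apply: nested.
by exists z; rewrite !inE qz ?leqnn // (negPf nxz).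
Qed.

Lemma exists_good lt q : interval_order_of e lt -> exists a b, good e q a b.
Proof.
move=> ltP; have ltP' := interval_order_converse ltP.
have [irr fer farE] := ltP.
suff: (exists a b, lt a b /\ forall x z, hull e q x -> comp e q z -> far e x z ->
    linked e lt (a, b) (x, z)) \/ (forall x z, hull e q x -> comp e q z -> cadj e x z).
  case=> [[a [b [ab lab]]]|adj]; last first.
    (* There is no far pair to orient. The pair (q, q) forces nothing, so each [num_after] is 0,
       while each rank counts at least the vertex itself. *)
    exists q, q; apply/forallP => z; apply/forallP => x; apply/implyP => /andP[qz qx].
    rewrite /far adj //=.
    have nor y : orient e q q x y = false.
      apply/negP => /andP[xy h].
      have [Ex Ey] : (x, y) = (q, q); last by move: xy; rewrite Ex Ey /far cadjxx.
      apply: (connect_invariant (P := fun u => u = (q, q)) _ h) => // u v + uE.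
      by rewrite uE /force /= /far cadjxx.
    have d0 : num_after e q q q x = 0 by apply: eq_card0 => y; rewrite !inE nor andbF.
    by rewrite d0 orbb leqn0 eq_sym eqbF_neg -lt0n; apply/card_gt0P; exists z; rewrite !inE qz leqnn.
  have or_lt x z : hull e q x -> comp e q z -> orient e a b x z = lt x z.
    move=> qx qz; apply/idP/idP => [|xz]; first by move=> h; apply: (orient_lt e_sym ltP ab h).
    have fxz : far e x z by rewrite farE xz.
    by move: (lab _ _ qx qz fxz); rewrite /orient fxz /linked /directed /= ab xz.
  have or_gt x z : hull e q x -> comp e q z -> orient e b a x z = lt z x.
    move=> qx qz; rewrite (orient_swap _ _ _ _ e_sym).
    apply/idP/idP => [|zx]; first by move=> h; apply: (orient_lt e_sym ltP ab h).
    have fxz : far e x z by rewrite farE zx orbT.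
    have nxz : lt x z = false.
      by apply/negP => xz; have := fer _ _ _ _ xz zx; rewrite !irr.
    move: (lab _ _ qx qz fxz).
    by rewrite /orient /linked /directed /= ab nxz /= => ->; rewrite farE zx.
  exists a, b; apply/forallP => z; apply/forallP => x; apply/implyP => /andP[qz qx].
  by rewrite -(rank_num_after ltP or_lt) // -(rank_num_after ltP' or_gt) // or_lt // or_gt // farE.
have [/existsP[x0 /andP[qx0 /existsP[y0 oxy]]]|none] :=
    boolP [exists x, comp e q x && [exists y, overlaps e x y]].
  left; have [v yv xv] : exists2 v, cadj e y0 v & far e x0 v.
    by apply: nsubPn; case/and3P: oxy.
  (* The far pair beyond an overlap is put into its [lt]-direction, so that the seed yields [lt] and
     the swapped seed its converse. *)
  pose s := directed lt (x0, v).
  have sE : s = (s.1, s.2) by case: s.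
  exists s.1, s.2; split.
    move: xv; rewrite farE /s /directed /=; case: ifP => //= _.
  move=> x z qx qz xz; rewrite -sE.
  have g : guided e lt s x0 y0.
    apply: (guided_right e_sym ltP oxy yv xv).
    rewrite /s {1}/directed /=; case: ifP => _; first exact: connect0.
    by apply: (linked_swap ltP); rewrite /far cadj_sym.
  exact: linked_hull oxy g qx0 qx qz xz.
(* Links without overlap join twins, so the component is a single twin class and is adjacent to its
   whole hull. *)
right=> x z /existsP[t /andP[qt xt]] qz.
have twin y : comp e q y -> nsub e q y && nsub e y q.
  move=> qy.
  have [] // := connect_invariant (P := fun y => comp e q y /\ nsub e q y && nsub e y q) _ qy.
    move=> u v uv [qu /andP[squ suq]].
    have := link_overlaps uv; rewrite -(comp_eqr e_sym _ (connect1 uv)) qu.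
    case/orP=> [ouv|/andP[suv svu]].
      case/existsP: none; exists u; rewrite qu /=.
      by apply/existsP; exists v.
    by rewrite (nsub_trans squ) // (nsub_trans svu).
  by rewrite compxx nsubxx.
have /andP[_ tq] := twin _ qt; have /andP[sqz _] := twin _ qz.
by rewrite cadj_sym //; apply: (nsubP _ _ _ sqz); apply: (nsubP _ _ _ tq); rewrite cadj_sym // nsub_cadj.
Qed.
End GoodSeed.

(** * Gluing blocks *)

Section Region.
Variables (T : finType) (e : rel T).
Implicit Types (o p q t u x y z : T).

(* The hull of [o], minus the hull of [p] when [p] lies strictly inside it. *)
Definition piece o p x := hull e o x && ~~ (inner e o p && hull e p x).
(** By [edge_outE] the hull of p looks like p from outside, so this mark is all that a piece has to
    remember about its hole. *)
Definition piece_mark o p x := inner e o p && e x p.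

Variables (O Y : pred T) (h : bool) (p : T).

(* [O] is a component and [Y] the rest of its hull, or [O] is empty and [Y] is the
   whole vertex set. The hull of [p] is cut out of [Y] when [h] holds. *)
Definition hole x := h && hull e p x.
Definition region x := (O x || Y x) && ~~ hole x.
Definition region_mark x := h && e x p.
Definition top x :=
  ~~ hole x && (O x || Y x && [forall w, Y w ==> ~~ inner e w x]).
Definition rep x := if O x then x else fingraph.root (link e) x.
(** Vertices of [O] stay apart, and the rest is grouped by maximal hulls. Applying [rep] makes the
    result independent of which vertex of the maximal component is picked. By [exists_top] the
    default is not reached for x in [Y] outside the hole. *)
Definition block_rep x :=
  if O x then x else rep (odflt x [pick t | top t && Y t && hull e t x]).

Hypothesis e_sym : symmetric e.
Hypothesis OY : forall x, O x -> ~~ Y x.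
Hypothesis Y_hull : forall x y, Y x -> hull e x y -> Y y.
Hypothesis hY : h -> Y p.

Let link_csym : connect_sym (link e).
Proof. exact/sym_connect_sym/link_sym. Qed.

Lemma comp_root x : comp e x (fingraph.root (link e) x).
Proof. exact: connect_root. Qed.

Lemma root_comp x y :
  comp e x y = (fingraph.root (link e) x == fingraph.root (link e) y).
Proof. by rewrite (root_connect link_csym). Qed.

Lemma piece_comp o o' x : comp e o o' -> piece o p x = piece o' p x.
Proof. by move=> oo; rewrite /piece (hull_comp e_sym _ oo) (inner_comp e_sym _ oo). Qed.

Lemma piece_mark_comp o o' x : comp e o o' -> piece_mark o p x = piece_mark o' p x.
Proof. by move=> oo; rewrite /piece_mark (inner_comp e_sym _ oo). Qed.

Let Y_notO x : Y x -> O x = false.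
Proof. by move=> Yx; apply/negP => /OY; rewrite Yx. Qed.

Lemma Y_comp x y : comp e x y -> Y x -> Y y.
Proof. by move=> xy Yx; apply: Y_hull Yx (comp_hull xy). Qed.

Lemma hole_comp x y : comp e x y -> hole x = hole y.
Proof. by move=> xy; rewrite /hole (hull_compr e_sym _ xy). Qed.

Lemma hole_Y x : hole x -> Y x.
Proof. by case/andP=> /hY Yp; apply: Y_hull. Qed.

Lemma O_hole x : O x -> ~~ hole x.
Proof. by move=> /OY; apply: contra; apply: hole_Y. Qed.

Lemma top_comp x y : comp e x y -> Y x -> top x -> top y.
Proof.
move=> xy Yx; rewrite /top -(hole_comp xy) => /andP[-> ].
rewrite (Y_notO Yx) (Y_notO (Y_comp xy Yx)) Yx (Y_comp xy Yx) /= => /forallP xmax.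
apply/forallP => w; apply/implyP => Yw; rewrite -(inner_compr e_sym _ xy).
exact: implyP (xmax w) Yw.
Qed.

Lemma top_O x : O x -> top x.
Proof. by move=> Ox; rewrite /top O_hole // Ox. Qed.

Lemma top_region x : top x -> region x.
Proof. by rewrite /top /region => /andP[-> /orP[->//|/andP[->]]]; rewrite orbT. Qed.

Lemma rep_comp x : ~~ O x -> comp e x (rep x).
Proof. by rewrite /rep => /negPf->; apply: comp_root. Qed.

Lemma rep_top x : top x -> top (rep x) /\ O (rep x) = O x.
Proof.
rewrite /rep; case: ifPn => [->//|Ox tx].
have Yx : Y x by case/andP: tx => _; rewrite (negPf Ox) => /andP[].
split; first exact: top_comp (comp_root x) Yx tx.
exact/Y_notO/(Y_comp (comp_root x)).
Qed.

Lemma rep_idem x : top x -> rep (rep x) = rep x.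
Proof.
move=> /rep_top[_]; rewrite /rep; case: ifP => [->//|_ ->].
by rewrite (root_root link_csym).
Qed.

Lemma exists_top x : Y x -> ~~ hole x -> exists t, [&& top t, Y t & hull e t x].
Proof.
move=> Yx nhx.
have Px : Y x && hull e x x by rewrite Yx hullxx.
case: (@arg_maxnP _ x (fun t => Y t && hull e t x) (fun t => #|hull e t|) Px).
move=> t /andP[Yt tx] tmax; exists t; rewrite Yt tx !andbT /top.
have -> /= : ~~ hole t.
  apply: contra nhx; rewrite /hole => /andP[-> pt].
  exact: (hull_trans e_sym pt tx).
rewrite Yt orbC; apply/orP; left; apply/forallP => w; apply/implyP => Yw.
apply/negP => /andP[wt nwt].
have := tmax w; rewrite Yw (hull_trans e_sym wt tx) => /(_ isT); apply/negP.
rewrite -ltnNge; apply: proper_card; apply/properP; split.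
  by apply/fintype.subsetP => y; rewrite !unfold_in => ty; apply: (hull_trans e_sym wt ty).
exists w; rewrite unfold_in; first exact: hullxx.
apply: contra nwt => tw.
exact: (hull_antisym e_sym wt tw).
Qed.

Lemma top_unique t t' x :
  top t -> Y t -> top t' -> Y t' -> hull e t x -> hull e t' x -> comp e t t'.
Proof.
have max u u' : Y u -> top u' -> Y u' -> hull e u u' -> comp e u u'.
  move=> Yu /andP[_ +] Yu'; rewrite (Y_notO Yu') Yu' /= => /forallP/(_ u).
  by rewrite Yu /inner /= negb_and negbK => /orP[/negPf->|].
move=> tt Yt tt' Yt' tx t'x; have /orP[/max|/max] := hull_meet e_sym tx t'x.
  exact.
by rewrite comp_sym //; apply.
Qed.

Lemma block_repP x : Y x -> ~~ hole x ->
  [/\ top (block_rep x), Y (block_rep x), hull e (block_rep x) x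
    & rep (block_rep x) = block_rep x].
Proof.
move=> Yx nhx; rewrite /block_rep (Y_notO Yx).
case: pickP => [t /andP[/andP[tt Yt] tx]|/= no]; last first.
  by have [t] := exists_top Yx nhx; rewrite andbA no.
have Ot := Y_notO Yt.
have ct : comp e t (rep t) by apply: rep_comp; rewrite Ot.
split=> /=; [exact: (rep_top tt).1|exact: Y_comp ct Yt| |exact: rep_idem].
by rewrite -(hull_comp e_sym _ ct).
Qed.

Lemma block_rep_region x : region x ->
  [/\ top (block_rep x), rep (block_rep x) = block_rep x & O (block_rep x) = O x].
Proof.
case/andP=> /orP[Ox _|Yx nhx].
  by rewrite /block_rep Ox; split; rewrite ?top_O // /rep Ox.
by have [? /Y_notO ? _ ?] := block_repP Yx nhx; rewrite (Y_notO Yx).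
Qed.

Lemma block_rep_eq t x :
  top t -> Y t -> rep t = t -> Y x -> ~~ hole x -> (block_rep x == t) = hull e t x.
Proof.
move=> tt Yt rt Yx nhx; have [tb Yb bx rb] := block_repP Yx nhx.
apply/eqP/idP => [<-//|tx].
have := top_unique tt Yt tb Yb tx bx.
rewrite root_comp => /eqP E; move: rt rb; rewrite /rep !Y_notO // => <- <-.
by rewrite E.
Qed.

Lemma block_O t x : O t -> (region x && (block_rep x == t)) = (x == t).
Proof.
move=> Ot; apply/andP/eqP => [[rx /eqP E]|->].
  have [_ _] := block_rep_region rx; rewrite E Ot => /esym Ox.
  by move: E; rewrite /block_rep Ox.
by split; [apply/top_region/top_O|rewrite /block_rep Ot].
Qed.

Lemma top_inner t : top t -> Y t -> hull e t p -> h -> inner e t p.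
Proof.
case/andP=> + _ Yt tp hh; rewrite /hole hh /inner tp /=; apply: contra => ct.
by apply: comp_hull; rewrite comp_sym.
Qed.

Hypothesis h_inner : forall x, Y x -> inner e x p -> h.

Lemma block_Y t x : top t -> Y t -> rep t = t ->
  (region x && (block_rep x == t)) = piece t p x.
Proof.
move=> tt Yt rt; rewrite /piece /region.
have -> : inner e t p && hull e p x = inner e t p && hole x.
  rewrite /hole; case: (boolP (inner e t p)) => //= /(h_inner Yt) ->//.
have [Yx|nYx] := boolP (Y x); last first.
  have -> : hull e t x = false by apply: contraNF nYx; apply: Y_hull.
  rewrite orbF /=; apply/negP => /andP[/andP[Ox _]].
  rewrite /block_rep Ox => /eqP E; by move: nYx; rewrite E Yt.
rewrite orbT /=; have [hx|nhx] := boolP (hole x); last first.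
  by rewrite block_rep_eq // andbF andbT.
rewrite /= andbT; apply/esym/negP => /andP[tx]; case/negP.
have /andP[hh px] := hx.
case/orP: (hull_meet e_sym tx px) => [tp|pt]; first exact: top_inner.
by case/andP: tt; rewrite /hole hh pt.
Qed.

Lemma block_mark t x : top t -> Y t -> hull e t x -> region_mark x = piece_mark t p x.
Proof.
move=> tt Yt tx; rewrite /region_mark /piece_mark.
have [itp|nitp] := boolP (inner e t p); first by rewrite (h_inner Yt itp).
apply/negP => /andP[hh exp].
have ntp : ~~ hull e t p.
  by apply: contra nitp => tp; apply: top_inner.
have npt : ~~ hull e p t by case/andP: tt; rewrite /hole hh.
have := hull_disjoint_edge e_sym tx (hullxx e p) ntp npt.
by rewrite exp.
Qed.

(** A vertex of [O] lies outside each hull within [Y] and sees it uniformly. Two distinct maximal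
    hulls are not nested, so no edge runs between them. *)
Lemma edge_block_rep x y : region x -> region y -> block_rep x != block_rep y ->
  e x y = e (block_rep x) (block_rep y).
Proof.
have OYedge x' y' : O x' -> Y y' -> ~~ hole y' -> e x' y' = e x' (block_rep y').
  move=> Ox' Yy' nhy'; have [_ Yb bx _] := block_repP Yy' nhy'.
  apply: edge_outE => //; apply/negP => /(Y_hull Yb).
  by apply/negP/OY.
move=> /andP[/orP[Ox nhx|Yx nhx]] /andP[/orP[Oy nhy|Yy nhy]].
- by rewrite /block_rep Ox Oy.
- by move=> _; rewrite {1}/block_rep Ox; apply: OYedge.
- by move=> _; rewrite {2}/block_rep Oy e_sym [RHS]e_sym; apply: OYedge.
- have [tx Ybx bx rx] := block_repP Yx nhx; have [ty Yby cy ry] := block_repP Yy nhy.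
  move=> ne.
  have nc : ~~ comp e (block_rep x) (block_rep y).
    apply: contra ne; rewrite root_comp -{2}rx -{2}ry /rep !Y_notO //.
  have nxy : ~~ hull e (block_rep x) (block_rep y).
    by apply: contra nc => xy; apply: (top_unique tx Ybx ty Yby xy); apply: hullxx.
  have nyx : ~~ hull e (block_rep y) (block_rep x).
    by apply: contra nc => yx; rewrite comp_sym //; apply: (top_unique ty Yby tx Ybx yx); apply: hullxx.
  by rewrite !(@hull_disjoint_edge _ _ e_sym (block_rep x) (block_rep y)) ?hullxx.
Qed.

Lemma edge_top_Y t u : top t -> Y t -> rep t = t -> top u -> Y u -> rep u = u ->
  t != u -> e t u = false.
Proof.
move=> tt Yt rt tu Yu ru ne.
have nc : ~~ comp e t u by apply: contra ne; rewrite root_comp -{2}rt -{2}ru /rep !Y_notO.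
apply: (@hull_disjoint_edge _ _ e_sym t u); rewrite ?hullxx //.
  by apply: contra nc => xy; apply: (top_unique tt Yt tu Yu xy); apply: hullxx.
by apply: contra nc => yx; rewrite comp_sym //; apply: (top_unique tu Yu tt Yt yx); apply: hullxx.
Qed.

Definition block_size t := if O t then 1 else #|comp e t|.

(** Double counting for [glue]: the game controls numbers of top vertices, and the representative of
    a block accounts for [block_size] of them. *)
Lemma card_top (C : eqType) (f : T -> C) c :
  #|[pred x | top x && (f (rep x) == c)]|
  = \sum_(t | [&& top t, rep t == t & f t == c]) block_size t.
Proof.
rewrite -sum1_card (partition_big rep (fun t => [&& top t, rep t == t & f t == c])).
  apply: eq_bigr => t /and3P[tt /eqP rt fc]; rewrite sum1dep_card /block_size.
  case: ifPn => [Ot|nOt].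
    rewrite -[RHS](card1 t); apply: eq_card => x; rewrite !inE.
    apply/andP/eqP => [[/andP[tx _] /eqP E]|->]; last by rewrite rt tt fc eqxx.
    by have [_] := rep_top tx; rewrite E Ot => /esym Ox; move: E; rewrite /rep Ox.
  have Yt : Y t by case/andP: tt => _; rewrite (negPf nOt) => /andP[].
  apply: eq_card => x; rewrite !inE; apply/andP/idP => [[/andP[tx _] /eqP E]|tx].
    have [_] := rep_top tx; rewrite E (negPf nOt) => /esym Ox.
    by rewrite comp_sym // -E; apply: rep_comp; rewrite Ox.
  have E : rep x = t.
    rewrite -rt /rep (Y_notO Yt) (Y_notO (Y_comp tx Yt)).
    by apply/esym/eqP; rewrite -root_comp.
  by rewrite E fc eqxx (top_comp tx).
by move=> x; rewrite !inE => /andP[tx ->]; rewrite (rep_top tx).1 rep_idem ?eqxx.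
Qed.

End Region.

(** * Isomorphisms between marked vertex sets *)

Section Iso.
Variable T : finType.
Implicit Types (e : rel T) (A m : pred T).

Definition iso e A m e' A' m' := exists f g : T -> T,
  [/\ forall x, A x -> A' (f x) /\ g (f x) = x,
      forall y, A' y -> A (g y) /\ f (g y) = y,
      forall x y, A x -> A y -> e x y = e' (f x) (f y)
    & forall x, A x -> m x = m' (f x)].

Lemma iso_sym e A m e' A' m' : iso e A m e' A' m' -> iso e' A' m' e A m.
Proof.
case=> f [g [fA gA fe fm]]; exists g, f; split=> // [x y A'x A'y|x A'x].
  by have [Ax Ex] := gA x A'x; have [Ay Ey] := gA y A'y; rewrite fe // Ex Ey.
by have [Ax Ex] := gA x A'x; rewrite fm // Ex.
Qed.

Lemma iso_trans e1 A1 m1 e2 A2 m2 e3 A3 m3 :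
  iso e1 A1 m1 e2 A2 m2 -> iso e2 A2 m2 e3 A3 m3 -> iso e1 A1 m1 e3 A3 m3.
Proof.
case=> f [g [fA gA fe fm]] [f' [g' [fA' gA' fe' fm']]].
exists (f' \o f), (g \o g'); split=> /= [x Ax|y Ay|x y Ax Ay|x Ax].
- by have [/fA'[? ->] ->] := fA x Ax.
- by have [/gA[? ->] ->] := gA' y Ay.
- by rewrite fe // fe' //; [case: (fA x Ax)|case: (fA y Ay)].
- by rewrite fm // fm' //; case: (fA x Ax).
Qed.

Lemma eq_iso e A m e' A' m' B n B' n' :
  A =1 B -> (forall x, A x -> m x = n x) ->
  A' =1 B' -> (forall x, A' x -> m' x = n' x) ->
  iso e A m e' A' m' -> iso e B n e' B' n'.
Proof.
move=> AB mn AB' mn' [f [g [fA gA fe fm]]]; exists f, g; split.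
- by move=> x; rewrite -AB -AB' => /fA.
- by move=> y; rewrite -AB -AB' => /gA.
- by move=> x y; rewrite -!AB; apply: fe.
- move=> x; rewrite -AB => Ax; rewrite -mn // fm // mn' //.
  by case: (fA x Ax).
Qed.

(** Here B fills the hole of A. Edges between them depend only on the end in A, through n, so an
    isomorphism of A that respects n combines with any isomorphism of B. *)
Lemma iso_union e A B m e' A' B' m' (n : pred T) (n' : pred T) :
  (forall x, A x -> ~~ B x) -> (forall x, A' x -> ~~ B' x) ->
  (forall x y, A x -> B y -> e x y = n x) ->
  (forall x y, A' x -> B' y -> e' x y = n' x) ->
  symmetric e -> symmetric e' ->
  iso e A n e' A' n' -> (forall x y, A x -> A' y -> n x = n' y -> m x = m' y) ->
  iso e B m e' B' m' ->
  iso e (fun x => A x || B x) m e' (fun x => A' x || B' x) m'.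
Proof.
move=> AB AB' en en' e_sym e'_sym [f [g [fA gA fe fm]]] mm [f' [g' [fB gB fe' fm']]].
exists (fun x => if A x then f x else f' x), (fun y => if A' y then g y else g' y).
have nA x : B x -> A x = false by move=> Bx; apply/negP => /AB; rewrite Bx.
have nA' x : B' x -> A' x = false by move=> Bx; apply/negP => /AB'; rewrite Bx.
split.
- move=> x /orP[Ax|Bx]; first by rewrite Ax; have [-> ->] := fA x Ax.
  by rewrite nA //; have [B'x ->] := fB x Bx; rewrite B'x nA' // orbT.
- move=> x /orP[Ax|Bx]; first by rewrite Ax; have [-> ->] := gA x Ax.
  by rewrite nA' //; have [B'x ->] := gB x Bx; rewrite B'x nA // orbT.
- move=> x y /orP[Ax|Bx] /orP[Ay|By].
  + by rewrite Ax Ay fe.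
  + by rewrite Ax nA // (en _ _ Ax By) fm // (en' _ _ (fA x Ax).1 (fB y By).1).
  + by rewrite Ay nA // e_sym e'_sym (en _ _ Ay Bx) fm // (en' _ _ (fA y Ay).1 (fB x Bx).1).
  + by rewrite !nA // fe'.
- move=> x /orP[Ax|Bx]; last by rewrite nA // fm'.
  by rewrite Ax; apply: mm (fm x Ax); rewrite ?(fA x Ax).1.
Qed.

Lemma iso_blocks e A m e' A' m' (b b' s s' : T -> T) (X X' : pred T) :
  (forall x, A x -> X (b x)) -> (forall x, A' x -> X' (b' x)) ->
  (forall t, X t -> X' (s t) /\ s' (s t) = t) ->
  (forall t, X' t -> X (s' t) /\ s (s' t) = t) ->
  (forall x y, A x -> A y -> b x != b y -> e x y = e (b x) (b y)) ->
  (forall x y, A' x -> A' y -> b' x != b' y -> e' x y = e' (b' x) (b' y)) ->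
  (forall t u, X t -> X u -> t != u -> e t u = e' (s t) (s u)) ->
  (forall t, X t ->
    iso e (fun x => A x && (b x == t)) m e' (fun y => A' y && (b' y == s t)) m') ->
  iso e A m e' A' m'.
Proof.
move=> bX bX' sX sX' eb eb' es isoX.
have /choice[F FP] : forall t, exists f : T -> T, X t -> exists g,
  [/\ forall x, A x && (b x == t) -> (A' (f x) && (b' (f x) == s t)) /\ g (f x) = x,
      forall y, A' y && (b' y == s t) -> (A (g y) && (b (g y) == t)) /\ f (g y) = y,
      forall x y, A x && (b x == t) -> A y && (b y == t) -> e x y = e' (f x) (f y)
    & forall x, A x && (b x == t) -> m x = m' (f x)].
  move=> t; have [Xt|] := boolP (X t); last by exists id.
  by have [f fP] := isoX t Xt; exists f.
have /choice[G GP] : forall t, exists g : T -> T, X t ->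
  [/\ forall x, A x && (b x == t) -> (A' (F t x) && (b' (F t x) == s t)) /\ g (F t x) = x,
      forall y, A' y && (b' y == s t) -> (A (g y) && (b (g y) == t)) /\ F t (g y) = y,
      forall x y, A x && (b x == t) -> A y && (b y == t) -> e x y = e' (F t x) (F t y)
    & forall x, A x && (b x == t) -> m x = m' (F t x)].
  move=> t; have [Xt|] := boolP (X t); last by exists id.
  by have [g gP] := FP t Xt; exists g.
exists (fun x => F (b x) x), (fun y => G (s' (b' y)) y); split.
- move=> x Ax; have [FA _ _ _] := GP _ (bX x Ax).
  have [] := FA x; rewrite ?Ax ?eqxx // => /andP[-> /eqP->] E.
  by rewrite (sX _ (bX x Ax)).2.
- move=> y A'y; have [Xt st] := sX' _ (bX' y A'y).
  have [_ GA _ _] := GP _ Xt.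
  by have [] := GA y; rewrite ?A'y ?st ?eqxx // => /andP[-> /eqP->].
- move=> x y Ax Ay; have [FA _ Fe _] := GP _ (bX x Ax).
  have [FA' _ _ _] := GP _ (bX y Ay).
  have [bxy|nbxy] := eqVneq (b x) (b y).
    by rewrite -bxy; apply: Fe; rewrite ?Ax ?Ay ?bxy eqxx.
  have [] := FA x; rewrite ?Ax ?eqxx // => /andP[AFx /eqP bFx] _.
  have [] := FA' y; rewrite ?Ay ?eqxx // => /andP[AFy /eqP bFy] _.
  rewrite eb // eb' // bFx bFy; first by apply: es; rewrite ?bX.
  apply: contra nbxy => /eqP E.
  by rewrite -(sX _ (bX x Ax)).2 E (sX _ (bX y Ay)).2.
- move=> x Ax; have [_ _ _ Fm] := GP _ (bX x Ax).
  by apply: Fm; rewrite Ax eqxx.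
Qed.

End Iso.

Section Glue.
Variable T : finType.
Variables (e e' : rel T) (O Y O' Y' : pred T) (h h' : bool) (p p' : T).

Definition well_formed (e : rel T) (O Y : pred T) (h : bool) (p : T) :=
  [/\ symmetric e, forall x, O x -> ~~ Y x,
      forall x y, Y x -> hull e x y -> Y y, h -> Y p
    & forall x, Y x -> inner e x p -> h].

Hypothesis wf : well_formed e O Y h p.
Hypothesis wf' : well_formed e' O' Y' h' p'.
Variables (C : eqType) (lab lab' : T -> C).
Hypothesis e_irr : irreflexive e.
Hypothesis e'_irr : irreflexive e'.
Hypothesis lab_comp :
  forall x y, top e O Y h p x -> Y x -> comp e x y -> lab x = lab y.
Hypothesis lab_comp' :
  forall x y, top e' O' Y' h' p' x -> Y' x -> comp e' x y -> lab' x = lab' y.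
Hypothesis labO : forall x x', top e O Y h p x -> top e' O' Y' h' p' x' ->
  lab x = lab' x' -> [/\ O x = O' x', #|comp e x| = #|comp e' x'|
    & O x -> region_mark e h p x = region_mark e' h' p' x'].
Hypothesis labE : forall t u t' u', top e O Y h p t -> top e O Y h p u ->
  top e' O' Y' h' p' t' -> top e' O' Y' h' p' u' -> lab t = lab' t' -> lab u = lab' u' ->
  t != u -> t' != u' -> O t -> e t u = e' t' u'.
Variables s s' : T -> T.
Hypothesis sK : cancel s s'.
Hypothesis s'K : cancel s' s.
Hypothesis s_top : forall x, top e O Y h p x = top e' O' Y' h' p' (s x).
Hypothesis s_lab : forall x, top e O Y h p x -> lab x = lab' (s x).
Hypothesis s_iso : forall x, top e O Y h p x -> Y x ->
  iso e (piece e x p) (piece_mark e x p) e' (piece e' (s x) p') (piece_mark e' (s x) p').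

Let piso (e1 e2 : rel T) p1 p2 x y :=
  iso e1 (piece e1 x p1) (piece_mark e1 x p1) e2 (piece e2 y p2) (piece_mark e2 y p2).

(** The bijection [s] may tear a component apart, so it serves only to compare numbers of colours. A
    new bijection between block representatives is built from these numbers. *)
Lemma glue : iso e (region e O Y h p) (region_mark e h p)
                 e' (region e' O' Y' h' p') (region_mark e' h' p').
Proof.
have [e_sym OY Y_hull hY h_inner] := wf; have [e'_sym OY' Y_hull' hY' h_inner'] := wf'.
(* An isomorphism type of pieces is encoded as the set of vertices of the second graph whose pieces
   have it, so both sides use the same colours. Vertices of [O] are blocks by themselves and get a
   constant set. *)
pose f t := (lab t, if O t then [ffun => true] else [ffun y => `[< piso e e' p p' t y >]]).
pose g t := (lab' t, if O' t then [ffun => true]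
                     else [ffun y : T => `[< piso e' e' p' p' t y >]]).
pose X t := top e O Y h p t && (rep e O t == t).
pose X' t := top e' O' Y' h' p' t && (rep e' O' t == t).
have topY (x : T) : top e O Y h p x -> O x = false -> Y x.
  by case/andP=> _ /orP[->//|/andP[]].
have topY' (x : T) : top e' O' Y' h' p' x -> O' x = false -> Y' x.
  by case/andP=> _ /orP[->//|/andP[]].
have fg x : top e O Y h p x -> f (rep e O x) = g (rep e' O' (s x)).
  move=> tx; have tsx : top e' O' Y' h' p' (s x) by rewrite -s_top.
  have [OO _ _] := labO tx tsx (s_lab tx).
  have [_ Or] := rep_top e_sym OY Y_hull tx.
  have [_ Or'] := rep_top e'_sym OY' Y_hull' tsx.
  rewrite /f /g Or Or' -OO; case Ox: (O x).
    by rewrite /rep -OO Ox s_lab.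
  have Yx := topY _ tx Ox; have Ysx : Y' (s x) by apply: topY' => //; rewrite -OO.
  have cx : comp e x (rep e O x) by apply: rep_comp; rewrite Ox.
  have csx : comp e' (s x) (rep e' O' (s x)) by apply: rep_comp; rewrite -OO Ox.
  rewrite -(lab_comp tx Yx cx) -(lab_comp' tsx Ysx csx) s_lab //.
  congr pair; apply/ffunP => y; rewrite !ffunE; apply: asbool_equiv_eq.
  have i1 : piso e e' p p' (rep e O x) (rep e' O' (s x)).
    apply: eq_iso (s_iso tx Yx) => z; [exact: piece_comp|by move=> _; exact: piece_mark_comp| |].
      exact: piece_comp.
    by move=> _; exact: piece_mark_comp.
  by split=> [/(iso_trans (iso_sym i1))|/(iso_trans i1)].
have gf t t' : X t -> X' t' -> f t = g t' ->
    block_size e O t = block_size e' O' t'.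
  move=> /andP[tt _] /andP[tt' _] [lE _]; have [OE cE _] := labO tt tt' lE.
  by rewrite /block_size -OE cE.
(* All blocks of one colour have the same positive size, by [labO]; this factor cancels from the
   equal numbers of top vertices. *)
have fib c : #|[pred t | X t && (f t == c)]| = #|[pred t | X' t && (g t == c)]|.
  have : #|[pred x | top e O Y h p x && (f (rep e O x) == c)]| =
         #|[pred x | top e' O' Y' h' p' x && (g (rep e' O' x) == c)]|.
    rewrite -(fintype.card_image (can_inj sK)); apply: eq_card => y.
    rewrite -[y]s'K fintype.mem_image ?inE; last exact: can_inj sK.
    by rewrite s_top; case: (boolP (top _ _ _ _ _ (s _))) => //=; rewrite -s_top => /fg->.
  rewrite (card_top h p e_sym OY Y_hull) (card_top h' p' e'_sym OY' Y_hull').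
  have sz t : 0 < block_size e' O' t.
    rewrite /block_size; case: ifP => // _; apply/card_gt0P; exists t.
    by rewrite unfold_in; apply: compxx.
  have sz0 t : 0 < block_size e O t.
    rewrite /block_size; case: ifP => // _; apply/card_gt0P; exists t.
    by rewrite unfold_in; apply: compxx.
  have [t0 /andP[Xt0 /eqP ft0]|noX] := pickP [pred t | X t && (f t == c)].
    rewrite [in RHS](eq_bigr (fun=> block_size e O t0)); last first.
      move=> t' /and3P[tt' rt' /eqP gt']; apply/esym/gf; rewrite ?ft0 //.
      by rewrite /X' tt'.
    rewrite (eq_bigr (fun=> block_size e O t0)); last first.
      have [t1 t1c|noX'] := pickP [pred t' | X' t' && (g t' == c)].
        have /andP[X't1 /eqP gt1] := t1c.
        move=> t /and3P[tt rt /eqP ft].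
        by rewrite (gf t t1) ?(gf t0 t1) ?ft0 ?ft // /X tt.
      move=> t /and3P[tt rt /eqP ft].
      have X't : X' (rep e' O' (s t)).
        have tst : top e' O' Y' h' p' (s t) by rewrite -s_top.
        by rewrite /X' (rep_top e'_sym OY' Y_hull' tst).1 (rep_idem e'_sym OY' Y_hull' tst) eqxx.
      have := noX' (rep e' O' (s t)); rewrite /= X't -fg // (eqP rt) ft eqxx //.
    rewrite !sum_nat_const => /eqP; rewrite eqn_pmul2r // => /eqP E.
    transitivity #|[pred t | [&& top e O Y h p t, rep e O t == t & f t == c]]|.
      by apply: eq_card => t; rewrite !inE -andbA.
    by rewrite E; apply: eq_card => t; rewrite [LHS]unfold_in inE /X' /= andbA.
  rewrite big_pred0; last by move=> t; have := noX t; rewrite /= -andbA.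
  move=> /esym/eqP; rewrite sum_nat_eq0 => /forallP no.
  rewrite [LHS]eq_card0; last exact: noX.
  apply/esym/eq_card0 => t; rewrite inE.
  apply/negP => /andP[/andP[tt rt] gt]; have /implyP := no t.
  by rewrite tt rt gt -leqn0 leqNgt sz => /(_ isT).
have [[t0]|noT] := pselect (exists t0 : T, True); last first.
  by exists id, id; split=> x; case: noT; exists x.
move=> _; have [r [r' [rP r'P]]] := fiber_bijection t0 t0 fib.
have XY t : X t -> O t = false -> Y t by case/andP=> /topY.
apply: (iso_blocks (b := block_rep e O Y h p) (b' := block_rep e' O' Y' h' p')
  (s := r) (s' := r') (X := X) (X' := X')).
- by move=> x /(block_rep_region e_sym OY Y_hull hY)[tb rb _]; rewrite /X tb rb eqxx.
- by move=> x /(block_rep_region e'_sym OY' Y_hull' hY')[tb rb _]; rewrite /X' tb rb eqxx.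
- by move=> t /rP[].
- by move=> t /r'P[].
- by move=> x y; apply: edge_block_rep.
- by move=> x y; apply: edge_block_rep.
- move=> t u Xt Xu tu; have [X'rt [lt _] rt] := rP t Xt; have [X'ru [lu _] ru] := rP u Xu.
  have ne : r t != r u by apply: contra tu => /eqP E; rewrite -rt E ru.
  have /andP[tt /eqP ret] := Xt; have /andP[tu' /eqP reu] := Xu.
  have /andP[trt /eqP rert] := X'rt; have /andP[tru /eqP reru] := X'ru.
  case Ot: (O t); first by apply: labE.
  case Ou: (O u).
    by rewrite e_sym e'_sym; apply: labE; rewrite // eq_sym.
  have [Ort _ _] := labO tt trt (esym lt); have [Oru _ _] := labO tu' tru (esym lu).
  rewrite (edge_top_Y e_sym OY tt (topY _ tt Ot) ret tu' (topY _ tu' Ou) reu tu).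
  by rewrite (edge_top_Y e'_sym OY' trt _ rert tru _ reru ne) //; apply: topY'; rewrite -?Ort -?Oru.
- move=> t Xt; have [X'rt [lt gr] rt] := rP t Xt.
  have /andP[tt /eqP ret] := Xt; have /andP[trt /eqP rert] := X'rt.
  have [Ort _ mark_t] := labO tt trt (esym lt).
  case Ot: (O t).
    apply: (eq_iso (A := pred1 t) (A' := pred1 (r t)) (m := region_mark e h p)
                   (m' := region_mark e' h' p')) => //.
    + by move=> x; rewrite (block_O e_sym OY Y_hull hY).
    + by move=> x; rewrite (block_O e'_sym OY' Y_hull' hY') // -Ort.
    + exists (fun=> r t), (fun=> t); split=> [x /eqP->|x /eqP->|x y /eqP-> /eqP->|x /eqP->] //=.
        by rewrite e_irr e'_irr.
      exact: mark_t.
  have Yt := topY _ tt Ot; have Yrt : Y' (r t) by apply: topY'; rewrite -?Ort.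
  have it : piso e e' p p' t (r t).
    move: gr; rewrite -Ort Ot => /ffunP/(_ (r t)); rewrite !ffunE => gr.
    apply/asboolP; rewrite -gr; apply/asboolP.
    by exists id, id; split.
  apply: eq_iso it => x.
  + by rewrite -(block_Y e_sym OY Y_hull h_inner).
  + by case/andP=> tx _; rewrite -(block_mark e_sym h_inner tt Yt tx).
  + by rewrite -(block_Y e'_sym OY' Y_hull' h_inner').
  + by case/andP=> tx _; rewrite -(block_mark e'_sym h_inner' trt Yrt tx).
Qed.
End Glue.

(** * Counting logic *)

Local Open Scope classical_set_scope.
Local Open Scope card_scope.

Lemma card_eq_pred (T : finType) (P : pred T) : [set a | P a] #= `I_#|P|.
Proof.
have -> : [set a | P a] = [set enum_val i | i in [set: 'I_#|P|]].
  apply/seteqP; split=> [a Pa|_ [i _ <-]] /=; last exact: (enum_valP i).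
  by exists (enum_rank_in (Pa : a \in P) a) => //; rewrite enum_rankK_in.
apply: card_eq_trans (card_esym card_II); apply: inj_card_eq.
by move=> i j _ _; apply: enum_val_inj.
Qed.

Section Satisfaction.
Variable k : nat.
Implicit Types (phi : formula k).

Lemma card_le_preim (T U : Type) (h : T -> U) (g : U -> T) (A : set U) (m : nat) :
  cancel h g -> cancel g h -> (`I_m #<= h @^-1` A) = (`I_m #<= A).
Proof.
move=> hg gh; apply: card_le_eqr.
have -> : h @^-1` A = g @` A.
  apply/seteqP; split=> [x Ax|_ [y Ay <-]] /=; last by rewrite gh.
  by exists (h x).
by apply: inj_card_eq => x y _ _; apply: can_inj gh _ _.
Qed.

Lemma sat_isomorphic (G H : graph) (h : G -> H) :
  bijective h -> (forall x y, edge x y <-> edge (h x) (h y)) ->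
  forall phi (v : 'I_k -> option G), sat v phi <-> sat (fun i => omap h (v i)) phi.
Proof.
move=> [g hg gh] hE.
have upd (v : 'I_k -> option G) x a :
    ([eta (fun i => omap h (v i)) with x |-> Some (h a)] : 'I_k -> option H)
    = (fun i => omap h ([eta v with x |-> Some a] i)).
  by apply/funext => i /=; case: (i == x).
have omapE (o : option G) b : omap h o = Some b <-> o = Some (g b).
  by case: o => [a|] //=; split=> [[<-]|[->]]; rewrite ?hg ?gh.
elim=> [x y|x y|p IHp|p IHp q IHq|p IHp q IHq|x p IHp|x p IHp|m x p IHp] v /=.
- split=> [[a [-> ->]]|[b [/omapE-> /omapE->]]]; first by exists (h a).
  by exists (g b).
- split=> [[a [b [-> -> ab]]]|[a [b [/omapE-> /omapE-> ab]]]].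
    by exists (h a), (h b); split=> //; apply/hE.
  by exists (g a), (g b); split=> //; apply/hE; rewrite !gh.
- by rewrite IHp.
- by rewrite IHp IHq.
- by rewrite IHp IHq.
- split=> [[a]|[b pb]]; first by rewrite IHp -upd; exists (h a).
  by exists (g b); rewrite IHp -upd gh.
- split=> [pa b|pb a]; last by rewrite IHp -upd.
  by move: (pa (g b)); rewrite IHp -upd gh.
- rewrite -(card_le_preim _ _ hg gh).
  suff -> : [set a | sat [eta v with x |-> Some a] p] =
     h @^-1` [set b | sat [eta fun i => omap h (v i) with x |-> Some b] p] by [].
  by apply/funext=> a /=; apply/propext; rewrite IHp -upd.
Qed.

Definition conj_seq phi (s : seq (formula k)) := foldr (@FAnd k) phi s.

Lemma sat_conj_seq (G : graph) (v : 'I_k -> option G) phi s :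
  sat v (conj_seq phi s) <-> sat v phi /\ forall p, List.In p s -> sat v p.
Proof.
elim: s => [|p s IHs] /=; first by split=> // -[].
rewrite IHs; split=> [[vp [vphi vs]]|[vphi vs]].
  by split=> // q [<-//|]; apply: vs.
split; first by apply: vs; left.
by split=> // q qs; apply: vs; right.
Qed.

Lemma qdepth_conj_seq phi s d :
  qdepth phi <= d -> (forall p, List.In p s -> qdepth p <= d) ->
  qdepth (conj_seq phi s) <= d.
Proof.
move=> phid; elim: s => [|p s IHs] //= sd; rewrite geq_max sd /=; last by left.
by apply: IHs => q qs; apply: sd; right.
Qed.

Lemma sentence_conj_seq phi s :
  sentence phi -> (forall p, List.In p s -> sentence p) ->
  sentence (conj_seq phi s).
Proof.
move=> phi0; elim: s => [|p s IHs] //= sP.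
rewrite /sentence /= IHs ?sP; [by rewrite finset.setU0|by left|].
by move=> q qs; apply: sP; right.
Qed.

(** Sentences are evaluated from the empty assignment, the game from total ones. Quantifying every
    variable connects the two, at the price of depth [k]. *)
Definition ex_closure phi := foldr (@FEx k) phi (enum 'I_k).

Lemma qdepth_ex_closure phi : qdepth (ex_closure phi) = k + qdepth phi.
Proof.
have qE r : qdepth (foldr (@FEx k) phi r) = size r + qdepth phi.
  by elim: r => //= i r ->.
by rewrite /ex_closure qE size_enum_ord.
Qed.

Lemma sentence_ex_closure phi : sentence (ex_closure phi).
Proof.
have fvE r : free_vars (foldr (@FEx k) phi r) = (free_vars phi :\: [set:: r])%SET.
  elim: r => [|i r IHr] /=.
    by apply/setP => j; rewrite !inE.
  by rewrite IHr; apply/setP => j; rewrite !inE negb_or andbA.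
rewrite /sentence /ex_closure fvE; apply/setP => j.
by rewrite !inE mem_enum.
Qed.

Lemma sat_ex_closure (G : graph) (v : 'I_k -> option G) phi :
  sat v (ex_closure phi) <-> exists s : 'I_k -> G, sat (fun i => Some (s i)) phi.
Proof.
have satE r (w : 'I_k -> option G) : sat w (foldr (@FEx k) phi r) <->
    exists u, [/\ forall i, i \notin r -> u i = w i,
                  forall i, i \in r -> u i <> None & sat u phi].
  elim: r w => [|j r IHr] w /=.
    split=> [wphi|[u [uw _]]]; first by exists w.
    by have -> : u = w by apply/funext => i; apply: uw.
  split=> [[a /IHr[u [uw uS uphi]]]|[u [uw uS uphi]]].
    exists u; split=> // i; rewrite inE.
      by rewrite negb_or => /andP[ij ir]; rewrite uw //= (negPf ij).
    case: (boolP (i \in r)) => [ir _|ir]; first exact: uS.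
    by rewrite orbF uw //= => ->.
  case Euj : (u j) => [a|]; last by case: (uS j _ Euj); rewrite inE eqxx.
  exists a; apply/IHr; exists u; split=> // i ir; last by apply: uS; rewrite inE ir orbT.
  rewrite /=; case: (eqVneq i j) => [->//|ij].
  by apply: uw; rewrite inE negb_or ij.
rewrite satE; split=> [[u [_ uS uphi]]|[s sphi]]; last first.
  by exists (fun i => Some (s i)); split=> // i; rewrite mem_enum.
have /choice[s sE] : forall i, exists a, u i = Some a.
  move=> i; case E : (u i) => [a|]; first by exists a.
  by case: (uS i _ E); rewrite mem_enum.
by exists s; move: uphi; congr sat; apply/funext.
Qed.

End Satisfaction.

(** * Equivalence up to a quantifier depth and the bijective pebble game *)

Section Equivalence.
Variables (T : finType) (k : nat).
Implicit Types (e : rel T) (s : 'I_k -> T) (l : seq T) (d : nat).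

Definition graph_of e : graph := @Graph T e.

Definition holds (p : rel T * ('I_k -> T)) (phi : formula k) :=
  @sat (graph_of p.1) k (fun i => Some (p.2 i)) phi.

Definition equivalent d p p' :=
  forall phi, qdepth phi <= d -> holds p phi <-> holds p' phi.

Definition update s i a : 'I_k -> T := fun j => if j == i then a else s j.

Lemma equivalent_sym d p p' : equivalent d p p' -> equivalent d p' p.
Proof. by move=> pp' phi /pp'->. Qed.

Lemma equivalent_trans d p q r :
  equivalent d p q -> equivalent d q r -> equivalent d p r.
Proof. by move=> pq qr phi hphi; rewrite pq // qr. Qed.

Lemma separating_formula d p p' :
  ~ equivalent d p p' -> exists phi, [/\ qdepth phi <= d, holds p phi & ~ holds p' phi].
Proof.
move=> /existsNP[phi /not_implyP[phid npp']].
have [pphi|npphi] := pselect (holds p phi).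
  by exists phi; split=> // p'phi; apply: npp'.
exists (FNot phi); split=> //= p'phi; apply: npp'; split=> //.
Qed.

(** Counting quantifiers give infinitely many formulas of depth [d], but only finitely many
    competitors have to be excluded, so a finite conjunction is enough. The variable [i0] serves to
    write a tautology. *)
Lemma isolating_formula (I : finType) (P : I -> rel T * ('I_k -> T)) d p (i0 : 'I_k) :
  exists phi, [/\ qdepth phi <= d, holds p phi
    & forall i, holds (P i) phi -> equivalent d p (P i)].
Proof.
have /choice[f fP] : forall i, exists phi, [/\ qdepth phi <= d, holds p phi
    & holds (P i) phi -> equivalent d p (P i)].
  move=> i; have [pi|/separating_formula[phi [? ? ?]]] := pselect (equivalent d p (P i)).
    exists (FOr (FEq i0 i0) (FNot (FEq i0 i0))); split=> //=.
    by left; exists (p.2 i0).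
  by exists phi; split.
exists (conj_seq (FOr (FEq i0 i0) (FNot (FEq i0 i0))) (map f (enum I))).
have inf phi : List.In phi (map f (enum I)) -> exists i, phi = f i.
  by elim: (enum I) => //= i r IHr [<-|/IHr//]; exists i.
split=> [||i].
- by apply: qdepth_conj_seq => // _ /inf[i ->]; case: (fP i).
- apply/sat_conj_seq; split; first by left; exists (p.2 i0).
  by move=> _ /inf[i ->]; case: (fP i).
- move=> /sat_conj_seq[_ h]; have [_ _] := fP i; apply; apply: h.
  have : i \in enum I by rewrite mem_enum.
  elim: (enum I) => //= j r IHr; rewrite inE => /orP[/eqP->|/IHr]; first by left.
  by right.
Qed.

(** Colour every one-vertex extension, in both graphs at once, by its class under depth-[d]
    equivalence. The isolating formula of a class under [FExGe m i], for all m, shows that the class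
    has equally many members on both sides. *)
Lemma equivalent_move d e e' s s' i :
  equivalent d.+1 (e, s) (e', s') -> exists f g : T -> T,
    [/\ cancel f g, cancel g f
      & forall a, equivalent d (e, update s i a) (e', update s' i (f a))].
Proof.
move=> ss'.
pose P (z : bool * T) : rel T * ('I_k -> T) :=
  if z.1 then (e, update s i z.2) else (e', update s' i z.2).
pose F z : {ffun bool * T -> bool} := [ffun y => `[< equivalent d (P y) (P z) >]].
have FE y z : F y = F z <-> equivalent d (P y) (P z).
  split=> [/ffunP/(_ y)|yz]; last first.
    apply/ffunP => w; rewrite !ffunE; apply: asbool_equiv_eq.
    split=> wy; first exact: equivalent_trans yz.
    exact: equivalent_trans (equivalent_sym yz).
  by rewrite !ffunE => h; apply/asboolP; rewrite -h; apply/asboolP.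
have satE (e1 : rel T) s1 b phi m : (forall a, P (b, a) = (e1, update s1 i a)) ->
    holds (e1, s1) (FExGe m i phi) <-> m <= #|[pred a | `[< holds (P (b, a)) phi >]]|.
  move=> PE; rewrite -card_le_II -(card_le_eqr (card_eq_pred _)).
  rewrite /holds /=; suff -> : (fun a : T => sat (G := graph_of e1)
      [eta fun j => Some (s1 j) with i |-> Some a] phi) =
      [set a | [pred a | `[< holds (P (b, a)) phi >]] a] by [].
  apply/funext => a; apply/propext; rewrite /= asboolE PE /holds /=.
  suff -> : ([eta fun j => Some (s1 j) with i |-> Some a] : _ -> _) =
    (fun j => Some (update s1 i a j)) by [].
  by apply/funext => j /=; rewrite /update; case: ifP.
have fib c : #|[pred a | predT a && (F (true, a) == c)]| =
             #|[pred a | predT a && (F (false, a) == c)]|.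
  have [[z zc]|nc] := pselect (exists z, F z = c); last first.
    by rewrite !eq_card0 // => a; rewrite !inE /=; apply/eqP => Fc; apply: nc; eexists; apply: Fc.
  have [phi [phid zphi phiP]] := isolating_formula P d (P z) i.
  have phiE y : (F y == c) = `[< holds (P y) phi >].
    rewrite -zc; apply/eqP/asboolP => [/FE yz|py]; last by apply/FE; apply: equivalent_sym (phiP _ py).
    exact/(yz phi phid).
  have le m : (m <= #|[pred a | `[< holds (P (true, a)) phi >]]|) =
              (m <= #|[pred a | `[< holds (P (false, a)) phi >]]|).
    have h := ss' (FExGe m i phi) phid.
    have hT := satE e s true phi m (fun=> erefl).
    have hF := satE e' s' false phi m (fun=> erefl).
    by apply/idP/idP; [move/hT/h/hF|move/hF/h/hT].
  rewrite (@eq_card _ _ [pred a | `[< holds (P (true, a)) phi >]]); last by move=> a; rewrite !inE phiE.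
  rewrite [RHS](@eq_card _ _ [pred a | `[< holds (P (false, a)) phi >]]); last by move=> a; rewrite !inE phiE.
  by apply/eqP; rewrite eqn_leq -le leqnn le leqnn.
have [f [g [fP gP]]] := fiber_bijection (s i) (s i) fib.
exists f, g; split=> [a|a|a]; [by case: (fP a isT)|by case: (gP a isT)|].
have [_ Ea _] := fP a isT.
by apply/(FE (true, a) (false, f a)).
Qed.

(* [l] and [l'] are read off two assignments that formulas of depth at most [d]
   cannot tell apart. Repetitions and reindexing are free, and [agree_move] is the
   bijective pebble game. *)
Definition agree d e e' l l' := exists s s' (I : seq 'I_k),
  [/\ equivalent d (e, s) (e', s'), l = map s I & l' = map s' I].

Lemma agree_sym d e e' l l' : agree d e e' l l' -> agree d e' e l' l.
Proof.
by move=> [s [s' [I [/equivalent_sym h -> ->]]]]; exists s', s, I.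
Qed.

Lemma agree_mono d d' e e' l l' : d <= d' -> agree d' e e' l l' -> agree d e e' l l'.
Proof.
move=> dd' [s [s' [I [h -> ->]]]]; exists s, s', I; split=> // phi phid.
exact/h/(leq_trans phid).
Qed.

Lemma agree_sub (J : seq nat) x0 d e e' l l' :
  agree d e e' l l' -> all (fun j => j < size l) J ->
  agree d e e' (map (nth x0 l) J) (map (nth x0 l') J).
Proof.
move=> [s [s' [I [h -> ->]]]]; rewrite size_map => /allP JI.
case: J JI => [|j0 J] JI; first by exists s, s', [::].
have i0 : 'I_k by case: I JI => [|//] /(_ j0 (mem_head _ _)).
by exists s, s', (map (nth i0 I) (j0 :: J)); split; rewrite // -map_comp;
  apply/eq_in_map => j jJ /=; rewrite (nth_map i0) ?JI.
Qed.

Lemma agree_move d e e' l l' :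
  agree d.+1 e e' l l' -> size l < k -> exists f g : T -> T,
    [/\ cancel f g, cancel g f & forall a, agree d e e' (a :: l) (f a :: l')].
Proof.
move=> [s [s' [I [h -> ->]]]]; rewrite size_map => Ik.
have [i iI] : exists i, i \notin I.
  apply/existsP; apply: contraLR Ik; rewrite negb_exists => /forallP all_I.
  rewrite -leqNgt -[k in k <= _]card_ord.
  apply: leq_trans (card_size I); apply: subset_leq_card.
  by apply/fintype.subsetP => i _; move: (all_I i); rewrite negbK.
have [f [g [fg gf fP]]] := equivalent_move i h.
exists f, g; split=> // a; exists (update s i a), (update s' i (f a)), (i :: I).
by split=> //=; rewrite {1}/update eqxx; congr cons;
  apply/eq_in_map => j jI; rewrite /update; case: eqP => // ji;
  rewrite -ji jI in iI.
Qed.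

Lemma agree_atomic d e e' x y x' y' : agree d e e' [:: x; y] [:: x'; y'] ->
  ((x == y) = (x' == y')) * (e x y = e' x' y').
Proof.
case=> s [s' [I [h]]].
case: I => [//|i [//|j [|//]]] [-> ->] [-> ->]; split.
  have := h (FEq i j) isT; rewrite /holds /= => hE.
  apply/eqP/eqP => E.
    by have /hE[b [[->] [->]]] : exists a, Some (s i) = Some a /\ Some (s j) = Some a
      by exists (s i); rewrite E.
  by have /hE[b [[->] [->]]] : exists a, Some (s' i) = Some a /\ Some (s' j) = Some a
    by exists (s' i); rewrite E.
have := h (FEdge i j) isT; rewrite /holds /= => hE.
apply/idP/idP => E.
  by have /hE[a [b [[->] [->]]]] : exists a b, [/\ Some (s i) = Some a, Some (s j) = Some b & e a b]
    by exists (s i), (s j).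
by have /hE[a [b [[->] [->]]]] : exists a b, [/\ Some (s' i) = Some a, Some (s' j) = Some b & e' a b]
  by exists (s' i), (s' j).
Qed.

End Equivalence.

(** * Definability in logarithmic depth *)

(** Path doubling: each level quantifies one midpoint. Level 0 is reflexive, so level j captures all
    walks of length at most 2^j, not only those of exact length. *)
Fixpoint walk (W : finType) (r : rel W) (j : nat) : rel W := fun u v =>
  if j is j'.+1 then [exists w, walk r j' u w && walk r j' w v]
  else (u == v) || r u v.

Lemma walkS (W : finType) (r : rel W) j u v :
  walk r j.+1 u v = [exists w, walk r j u w && walk r j w v].
Proof. by []. Qed.

Lemma walkP (W : finType) (r : rel W) j u v :
  reflect (exists p, [/\ path r u p, last u p = v & size p <= 2 ^ j]) (walk r j u v).
Proof.
elim: j u v => [|j IHj] u v /=.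
  apply: (iffP orP) => [[/eqP->|uv]|[[|w [|? ?]] /= []]] //.
  - by exists [::].
  - by exists [:: v]; rewrite /= uv.
  - by move=> _ ->; left.
  - by rewrite andbT => uw <-; right.
apply: (iffP existsP) => [[w /andP[/IHj[p [up <- sp]] /IHj[q [wq <- sq]]]]|].
  exists (p ++ q); rewrite cat_path up wq last_cat size_cat; split=> //.
  by rewrite expnS mul2n -addnn leq_add.
case=> p [up vE sp]; exists (last u (take (2 ^ j) p)).
move: up vE; rewrite -{1 2}(cat_take_drop (2 ^ j) p) cat_path last_cat.
move=> /andP[up wp] vE.
apply/andP; split; apply/IHj.
  by exists (take (2 ^ j) p); split=> //; rewrite size_take; case: ltnP => // /ltnW.
exists (drop (2 ^ j) p); split=> //.
by rewrite size_drop leq_subLR addnn -mul2n -expnS.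
Qed.

Lemma connect_walk (W : finType) (r : rel W) j u v :
  #|W| <= 2 ^ j -> connect r u v = walk r j u v.
Proof.
move=> Wj; apply/connectP/walkP => [[p up ->]|[p [up <- _]]]; last by exists p.
case/shortenP: up => q uq uniq_q _; exists q; split=> //.
have : size (u :: q) <= #|W| by rewrite -(card_uniqP uniq_q) max_card.
by move=> /= /ltnW /leq_trans; apply.
Qed.

Section Invariance.
Variables (T : finType) (j : nat).
Hypothesis Tj : #|T| <= 2 ^ j.
Implicit Types (e : rel T) (d : nat) (l : seq T) (a b o p q x y z : T).
Local Notation agree := (@agree T 8).

Lemma agree_forth d e e' l l' a : agree d.+1 e e' l l' -> size l < 8 ->
  exists a', agree d e e' (a :: l) (a' :: l').
Proof. by move=> H /(agree_move H)[f [g [_ _ fP]]]; exists (f a). Qed.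

Lemma agree_card d e e' l l' (P P' : pred T) : agree d.+1 e e' l l' -> size l < 8 ->
  (forall a a', agree d e e' (a :: l) (a' :: l') -> P a = P' a') ->
  #|[pred a | P a]| = #|[pred a | P' a]|.
Proof.
move=> H /(agree_move H)[f [g [fg gf fP]]] PP'.
rewrite -(fintype.card_image (can_inj fg)); apply: eq_card => a.
rewrite -[a]gf fintype.mem_image ?inE; last exact: can_inj fg.
exact: PP' (fP (g a)).
Qed.

Lemma agree_exists d e e' l l' (P P' : pred T) : agree d.+1 e e' l l' -> size l < 8 ->
  (forall a a', agree d e e' (a :: l) (a' :: l') -> P a = P' a') ->
  [exists a, P a] = [exists a, P' a].
Proof.
move=> H lt8 PP'; have E := agree_card H lt8 PP'.
have exE (Q : pred T) : [exists a, Q a] = (0 < #|[pred a | Q a]|).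
  by apply/existsP/card_gt0P => -[a Qa]; exists a.
by rewrite !exE E.
Qed.

Lemma agree_forall d e e' l l' (P P' : pred T) : agree d.+1 e e' l l' -> size l < 8 ->
  (forall a a', agree d e e' (a :: l) (a' :: l') -> P a = P' a') ->
  [forall a, P a] = [forall a, P' a].
Proof.
move=> H lt8 PP'; apply: negb_inj; rewrite !negb_forall.
by apply: agree_exists H lt8 _ => a a' /PP'->.
Qed.

Lemma agree_cadj d e e' x y x' y' : agree d e e' [:: x; y] [:: x'; y'] ->
  cadj e x y = cadj e' x' y'.
Proof. by move=> /agree_atomic H; rewrite /cadj !H. Qed.

Lemma agree_far d e e' x y x' y' : agree d e e' [:: x; y] [:: x'; y'] ->
  far e x y = far e' x' y'.
Proof. by move=> H; rewrite /far (agree_cadj H). Qed.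

Lemma agree_nsub d e e' x y x' y' : 0 < d -> agree d e e' [:: x; y] [:: x'; y'] ->
  nsub e x y = nsub e' x' y'.
Proof.
case: d => // d _ H; apply: agree_forall H isT _ => z z' H.
rewrite (agree_cadj (agree_sub (J := [:: 1; 0]) x H isT)).
by rewrite (agree_cadj (agree_sub (J := [:: 2; 0]) x H isT)).
Qed.

Lemma agree_link d e e' x y x' y' : 0 < d -> agree d e e' [:: x; y] [:: x'; y'] ->
  link e x y = link e' x' y'.
Proof.
move=> d0 H; rewrite /link (agree_cadj H) (agree_nsub d0 H).
by rewrite (agree_nsub d0 (agree_sub (J := [:: 1; 0]) x H isT)).
Qed.

(** One round for each doubling level, and one more for [nsub] inside [link]. *)
Lemma agree_comp d e e' x y x' y' : j < d -> agree d e e' [:: x; y] [:: x'; y'] ->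
  comp e x y = comp e' x' y'.
Proof.
rewrite /comp !(@connect_walk _ _ j) //.
elim: j d x y x' y' => [|i IHi] d x y x' y' id H.
  by rewrite /= (agree_link id H) (agree_atomic H).
case: d id H => // d id H; rewrite !walkS; apply: agree_exists H isT _ => z z' H.
rewrite (IHi d x z x' z' id (agree_sub (J := [:: 1; 0]) x H isT)).
by rewrite (IHi d z y z' y' id (agree_sub (J := [:: 0; 2]) x H isT)).
Qed.

Lemma agree_hull d e e' x y x' y' : j.+1 < d -> agree d e e' [:: x; y] [:: x'; y'] ->
  hull e x y = hull e' x' y'.
Proof.
case: d => // d jd H; apply: agree_exists H isT _ => z z' H.
rewrite (agree_comp _ (agree_sub (J := [:: 1; 0]) x H isT)) //.
by rewrite (agree_nsub _ (agree_sub (J := [:: 2; 0]) x H isT)) //; lia.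
Qed.

Lemma agree_inner d e e' x y x' y' : j.+1 < d -> agree d e e' [:: x; y] [:: x'; y'] ->
  inner e x y = inner e' x' y'.
Proof. by move=> jd H; rewrite /inner (agree_hull jd H) (agree_comp (ltnW jd) H). Qed.

Lemma agree_force d e e' x y z t x' y' z' t' :
  agree d e e' [:: x; y; z; t] [:: x'; y'; z'; t'] ->
  force e (x, y) (z, t) = force e' (x', y') (z', t').
Proof.
move=> H; rewrite /force /=.
rewrite (agree_far (agree_sub (J := [:: 0; 1]) x H isT)) (agree_far (agree_sub (J := [:: 2; 3]) x H isT)).
rewrite (agree_cadj (agree_sub (J := [:: 1; 3]) x H isT)) (agree_cadj (agree_sub (J := [:: 0; 2]) x H isT)).
by rewrite !(agree_atomic (agree_sub (J := [:: 0; 2]) x H isT)) !(agree_atomic (agree_sub (J := [:: 1; 3]) x H isT)).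
Qed.

Lemma exists_pair (P : pred (T * T)) : [exists w, P w] = [exists x, exists y, P (x, y)].
Proof.
apply/existsP/existsP => [[[x y] Pxy]|[x /existsP[y Pxy]]].
  by exists x; apply/existsP; exists y.
by exists (x, y).
Qed.

Lemma agree_orient d e e' a b x y a' b' x' y' : 4 * j <= d ->
  agree d e e' [:: a; b; x; y] [:: a'; b'; x'; y'] ->
  orient e a b x y = orient e' a' b' x' y'.
Proof.
move=> jd H; rewrite /orient (agree_far (agree_sub (J := [:: 2; 3]) x H isT)); congr (_ && _).
(* The walk runs on pairs of vertices: 2 * j doubling levels, each with two quantified vertices.
   Forcing itself is quantifier-free. *)
have T2 : #|{: T * T}| <= 2 ^ (2 * j).
  by rewrite card_prod mul2n -addnn expnD leq_mul.
rewrite !(connect_walk _ _ _ T2).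
have {jd} : 2 * (2 * j) <= d by rewrite mulnA.
elim: (2 * j) d a b x y a' b' x' y' H => [|i IHi] d a b x y a' b' x' y' H id.
  rewrite /= (agree_force H) !xpair_eqE.
  by rewrite !(agree_atomic (agree_sub (J := [:: 0; 2]) x H isT)) !(agree_atomic (agree_sub (J := [:: 1; 3]) x H isT)).
case: d H id => [|[|d]] H id; [lia|lia|].
rewrite !walkS !exists_pair; apply: agree_exists H isT _ => u u' H.
apply: agree_exists H isT _ => v v' H.
congr (_ && _); apply: (IHi d); try lia.
  exact: (agree_sub (J := [:: 2; 3; 1; 0]) x H isT).
exact: (agree_sub (J := [:: 1; 0; 4; 5]) x H isT).
Qed.

Lemma agree_num_before d e e' q a b z q' a' b' z' : 4 * j + 2 < d ->
  agree d e e' [:: q; a; b; z] [:: q'; a'; b'; z'] ->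
  num_before e q a b z = num_before e' q' a' b' z'.
Proof.
case: d => // d jd H; apply: agree_card H isT _ => x x' H.
rewrite (agree_hull _ (agree_sub (J := [:: 1; 0]) x H isT)); last lia.
by rewrite (agree_orient _ (agree_sub (J := [:: 2; 3; 0; 4]) x H isT)); last lia.
Qed.

Lemma agree_rank d e e' q a b z q' a' b' z' : 4 * j + 3 < d ->
  agree d e e' [:: q; a; b; z] [:: q'; a'; b'; z'] ->
  rank e q a b z = rank e' q' a' b' z'.
Proof.
case: d => // d jd H; apply: agree_card H isT _ => x x' H.
rewrite (agree_comp _ (agree_sub (J := [:: 1; 0]) x H isT)); last lia.
rewrite (agree_num_before _ (agree_sub (J := [:: 1; 2; 3; 0]) x H isT)); last lia.
by rewrite (agree_num_before _ (agree_sub (J := [:: 1; 2; 3; 4]) x H isT)); last lia.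
Qed.

Lemma agree_num_after d e e' q a b z q' a' b' z' : 4 * j + 3 < d ->
  agree d e e' [:: q; a; b; z] [:: q'; a'; b'; z'] ->
  num_after e q a b z = num_after e' q' a' b' z'.
Proof.
case: d => // d jd H; apply: agree_card H isT _ => x x' H.
rewrite (agree_comp _ (agree_sub (J := [:: 1; 0]) x H isT)); last lia.
by rewrite (agree_orient _ (agree_sub (J := [:: 2; 3; 4; 0]) x H isT)); last lia.
Qed.

Lemma agree_good d e e' q a b q' a' b' : 4 * j + 5 < d ->
  agree d e e' [:: q; a; b] [:: q'; a'; b'] -> good e q a b = good e' q' a' b'.
Proof.
case: d => [|[|d]] //; try lia; move=> jd H.
apply: agree_forall H isT _ => z z' H; apply: agree_forall H isT _ => x x' H.
rewrite (agree_comp _ (agree_sub (J := [:: 2; 1]) x H isT)); last lia.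
rewrite (agree_hull _ (agree_sub (J := [:: 2; 0]) x H isT)); last lia.
rewrite (agree_far (agree_sub (J := [:: 0; 1]) x H isT)).
rewrite (agree_rank _ (agree_sub (J := [:: 2; 3; 4; 1]) x H isT)); last lia.
rewrite (agree_rank _ (agree_sub (J := [:: 2; 4; 3; 1]) x H isT)); last lia.
rewrite (agree_num_after _ (agree_sub (J := [:: 2; 3; 4; 0]) x H isT)); last lia.
by rewrite (agree_num_after _ (agree_sub (J := [:: 2; 4; 3; 0]) x H isT)); last lia.
Qed.

Lemma agree_card_comp d e e' x x' : j.+1 < d -> agree d e e' [:: x] [:: x'] ->
  #|comp e x| = #|comp e' x'|.
Proof.
case: d => // d jd H; apply: (agree_card (P := comp e x) (P' := comp e' x') H isT) => y y' H'.
exact: agree_comp jd (agree_sub (J := [:: 1; 0]) x H' isT).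
Qed.

End Invariance.

(** * Reconstruction of pieces *)

Section Pieces.
Variables (T : finType) (e : rel T).
Hypothesis e_sym : symmetric e.
Implicit Types (o p q x y : T).

Lemma inner_hull q x y : inner e q x -> hull e x y -> inner e q y.
Proof.
move=> /andP[qx nqx] xy; rewrite /inner (hull_trans e_sym qx xy) /=.
apply: contra nqx => qy; apply: (hull_antisym e_sym qx).
by rewrite (hull_compr e_sym _ qy).
Qed.

Lemma hull_inner q x y : hull e q x -> inner e x y -> inner e q y.
Proof.
move=> qx /andP[xy nxy]; rewrite /inner (hull_trans e_sym qx xy) /=.
apply: contra nxy => qy; apply: (hull_antisym e_sym xy).
by apply: hull_trans qx => //; apply: comp_hull; rewrite comp_sym.
Qed.

Lemma hullE q x : hull e q x = comp e q x || inner e q x.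
Proof. by rewrite /inner; case: (boolP (comp e q x)) => [/comp_hull->|_] //=; rewrite andbT. Qed.

Lemma node_well_formed q p :
  well_formed e (comp e q) (inner e q) (inner e q p) p.
Proof.
split=> // [x qx|x y|x qx].
- by rewrite /inner qx andbF.
- exact: inner_hull.
- by case/andP=> xp _; apply: inner_hull qx xp.
Qed.

Lemma piece_out o q x : inner e o q -> piece e o q x -> ~~ hull e q x.
Proof. by rewrite /piece => -> /andP[]. Qed.

Lemma piece_split o q p x : inner e o q -> inner e q p = inner e o p ->
  piece e o p x = piece e o q x || piece e q p x.
Proof.
move=> oq Eqp; rewrite /piece oq Eqp /=.
have /andP[hoq _] := oq.
have [qx|nqx] := boolP (hull e q x); first by rewrite (hull_trans e_sym hoq qx).
rewrite orbF /= andbT; have [iop|] := boolP (inner e o p); last by rewrite andbT.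
suff -> : hull e p x = false by rewrite andbT.
apply: contraNF nqx; apply: hull_trans => //.
by move: iop; rewrite -Eqp => /andP[].
Qed.

Lemma piece_self o p : piece e o p o.
Proof.
rewrite /piece hullxx /=; apply/negP => /andP[/andP[op nop] po].
by case/negP: nop; apply: hull_antisym.
Qed.

End Pieces.

(** * Recursion on the size of a piece *)

Section Recursion.
Variables (T : finType) (j : nat).
Hypothesis Tj : #|T| <= 2 ^ j.
Variables (e e' : rel T).
Hypotheses (e_sym : symmetric e) (e'_sym : symmetric e').
Hypotheses (e_irr : irreflexive e) (e'_irr : irreflexive e').
Local Notation agree := (@agree T 8).

(** Both orientations are recorded because [good] reads a far pair from either. Ranks and adjacency
    to the hole are kept for members of the component of q only, since [glue] wants labels that are
    constant on child components. *)
Definition node_label (e : rel T) q p a b x :=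
  (comp e q x, #|comp e x|, (num_after e q a b x, num_after e q b a x),
   if comp e q x then (rank e q a b x, rank e q b a x, inner e q p && e x p)
   else (0, 0, false)).

Lemma agree_node_label d q p a b x q' p' a' b' x' : 4 * j + 3 < d ->
  agree d e e' [:: x; q; p; a; b] [:: x'; q'; p'; a'; b'] ->
  node_label e q p a b x = node_label e' q' p' a' b' x'.
Proof.
move=> jd H; rewrite /node_label.
rewrite (agree_comp Tj _ (agree_sub (J := [:: 1; 0]) x H isT)); last lia.
rewrite (agree_card_comp Tj _ (agree_sub (J := [:: 0]) x H isT)); last lia.
rewrite (agree_num_after Tj _ (agree_sub (J := [:: 1; 3; 4; 0]) x H isT)); last lia.
rewrite (agree_num_after Tj _ (agree_sub (J := [:: 1; 4; 3; 0]) x H isT)); last lia.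
rewrite (agree_rank Tj _ (agree_sub (J := [:: 1; 3; 4; 0]) x H isT)); last lia.
rewrite (agree_rank Tj _ (agree_sub (J := [:: 1; 4; 3; 0]) x H isT)); last lia.
rewrite (agree_inner Tj _ (agree_sub (J := [:: 1; 2]) x H isT)); last lia.
by rewrite (agree_atomic (agree_sub (J := [:: 0; 2]) x H isT)).
Qed.

Lemma agree_top d q p x q' p' x' : 4 * j + 3 < d ->
  agree d e e' [:: x; q; p] [:: x'; q'; p'] ->
  top e (comp e q) (inner e q) (inner e q p) p x =
  top e' (comp e' q') (inner e' q') (inner e' q' p') p' x'.
Proof.
case: d => // d jd H; rewrite /top /hole.
rewrite (agree_comp Tj _ (agree_sub (J := [:: 1; 0]) x H isT)); last lia.
rewrite (agree_hull Tj _ (agree_sub (J := [:: 2; 0]) x H isT)); last lia.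
rewrite (agree_inner Tj _ (agree_sub (J := [:: 1; 0]) x H isT)); last lia.
rewrite (agree_inner Tj _ (agree_sub (J := [:: 1; 2]) x H isT)); last lia.
congr (_ && (_ || _ && _)); apply: agree_forall H isT _ => w w' H.
rewrite (agree_inner Tj _ (agree_sub (J := [:: 2; 0]) x H isT)); last lia.
by rewrite (agree_inner Tj _ (agree_sub (J := [:: 0; 1]) x H isT)); last lia.
Qed.

Lemma good_far (r : rel T) q a b z x : good r q a b -> comp r q z -> hull r q x ->
  far r x z = (rank r q a b z <= num_after r q a b x) || (rank r q b a z <= num_after r q b a x).
Proof.
by move=> /forallP/(_ z)/forallP/(_ x)/implyP + qz qx; rewrite qz qx => /(_ isT)/eqP.
Qed.

Lemma edge_far (r : rel T) x y : x != y -> r x y = ~~ far r x y.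
Proof. by rewrite /far /cadj negbK => /negPf->. Qed.

Lemma top_hull (r : rel T) q h p x : top r (comp r q) (inner r q) h p x -> hull r q x.
Proof. by case/andP=> _ /orP[/comp_hull//|/andP[/andP[]]]. Qed.

(** The component of q plays the part of [O] and its child hulls that of [Y]; the one extra round
    supplies the bijection for [glue]. *)
Lemma node_iso d q p a b q' p' a' b' : 4 * j + 5 < d ->
  good e q a b -> agree d.+1 e e' [:: q; p; a; b] [:: q'; p'; a'; b'] ->
  (forall x x', inner e q x -> ~~ (inner e q p && hull e p x) ->
     agree d e e' [:: x; p] [:: x'; p'] ->
     iso e (piece e x p) (piece_mark e x p) e' (piece e' x' p') (piece_mark e' x' p')) ->
  iso e (piece e q p) (piece_mark e q p) e' (piece e' q' p') (piece_mark e' q' p').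
Proof.
move=> jd gd H IH.
have gd' : good e' q' a' b'.
  by rewrite -(agree_good Tj _ (agree_sub (J := [:: 0; 2; 3]) q H isT)) //; lia.
have [s [s' [sK s'K sL]]] := agree_move H isT.
have regE (r : rel T) (r_sym : symmetric r) u v x :
    region r (comp r u) (inner r u) (inner r u v) v x = piece r u v x.
  by rewrite /region /piece -hullE.
apply: (eq_iso (A := region e (comp e q) (inner e q) (inner e q p) p)
  (A' := region e' (comp e' q') (inner e' q') (inner e' q' p') p')
  (m := region_mark e (inner e q p) p) (m' := region_mark e' (inner e' q' p') p')) => //.
- exact: regE.
- exact: regE.
have labC (r : rel T) (r_sym : symmetric r) u v c1 c2 x y : inner r u x -> comp r x y ->
    node_label r u v c1 c2 x = node_label r u v c1 c2 y.
  move=> ux xy; rewrite /node_label.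
  have uy : inner r u y by rewrite -(inner_compr r_sym _ xy).
  have /andP[_ /negPf->] := ux; have /andP[_ /negPf->] := uy.
  rewrite !(num_after_comp r_sym _ _ xy ux); congr (_, _, _, _).
  by apply: eq_card => z; apply: (comp_eql r_sym z xy).
apply: (@glue _ _ _ _ _ _ _ _ _ _ _ (node_well_formed e_sym q p)
  (node_well_formed e'_sym q' p') _ (node_label e q p a b) (node_label e' q' p' a' b')
  e_irr e'_irr _ _ _ _ s s' sK s'K).
- by move=> x y _; apply: labC.
- by move=> x y _; apply: labC.
- move=> x x' _ _ [cE kE _ _]; rewrite cE; case: ifP => // cx' [_ _ mE].
  by split.
(* An edge at t in the component is read off the ranks of t and the [num_after] counts of the other
   end u, all of which the labels contain. *)
- move=> t u t' u' tt tu tt' tu' [ct _ _ _ +] [_ _ du1 du2 _] ntu ntu' Ot.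
  rewrite -ct Ot => -[rt1 rt2 _].
  have -> : e t u = ~~ far e u t by rewrite e_sym; apply: edge_far; rewrite eq_sym.
  have -> : e' t' u' = ~~ far e' u' t' by rewrite e'_sym; apply: edge_far; rewrite eq_sym.
  rewrite (good_far gd Ot (top_hull tu)) (good_far gd' _ (top_hull tu')) -?ct //.
  by rewrite rt1 rt2 du1 du2.
- by move=> x; apply: agree_top (agree_sub (J := [:: 0; 1; 2]) q (sL x) isT); lia.
- by move=> x _; apply: agree_node_label (sL x); lia.
- move=> x /andP[nhx _] Yx; apply: IH Yx nhx _.
  exact: (agree_sub (J := [:: 0; 2]) q (sL x) isT).
Qed.

Variable lt : rel T.
Hypothesis ltP : interval_order_of e lt.

Definition determined d o p := forall o' p', agree d e e' [:: o; p] [:: o'; p'] ->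
  iso e (piece e o p) (piece_mark e o p) e' (piece e' o' p') (piece_mark e' o' p').

Lemma determined_mono d d' o p : d <= d' -> determined d o p -> determined d' o p.
Proof. by move=> dd' D o' p' /(agree_mono dd')/D. Qed.

(** The cut at q leaves one hole on each side: q in the context, and p, if it was a hole, in the
    lower part. Minimality of q bounds only the children that still contain the hole; the others are
    free of holes but may be large, and are left to the last hypothesis. Three of the four extra
    rounds mark q, a and b, and the fourth is spent in [node_iso]. *)
Lemma determined_step s d o p : 4 * j + 5 < d ->
  (forall x y, #|piece e x y| < s -> determined d x y) ->
  #|piece e o p| < s + s ->
  (forall x, inner e o p -> ~~ inner e x p -> #|piece e x p| < s + s -> determined d x p) ->
  determined d.+4 o p.
Proof.
move=> jd IH szo IHleft; have [small|big] := ltnP #|piece e o p| s.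
  by apply: determined_mono (IH _ _ small); lia.
move=> o' p' H.
pose Q q := [&& hull e o q, inner e q p == inner e o p & s <= #|piece e q p|].
have Qo : Q o by rewrite /Q hullxx eqxx.
case: (@arg_minnP _ o Q (fun q => #|piece e q p|) Qo) => q /and3P[oq /eqP qp szq] qmin.
have [q' Hq] := agree_forth q H isT.
have [a [b gd]] := exists_good e_sym q ltP.
have [a' Ha] := agree_forth a Hq isT; have [b' Hb] := agree_forth b Ha isT.
have node : iso e (piece e q p) (piece_mark e q p)
                e' (piece e' q' p') (piece_mark e' q' p').
  apply: node_iso jd gd (agree_sub (J := [:: 2; 4; 1; 0]) q Hb isT) _.
  move=> x x' qx nhx Hx; have /andP[hqx nqx] := qx.
  have sub : #|piece e x p| < #|piece e q p|.
    apply: proper_card; apply/properP; split; last first.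
      exists q; rewrite unfold_in; first exact: piece_self.
      apply: contra nqx => /andP[xq _]; exact: hull_antisym.
    apply/fintype.subsetP => y; rewrite !unfold_in => /andP[xy nhy].
    rewrite (hull_trans e_sym hqx xy) /=; apply/negP => /andP[iqp py].
    move: nhy nhx; rewrite py andbT iqp /= => nxp.
    apply/negP; rewrite negbK; have /orP[xp|//] := hull_meet e_sym xy py.
    have : comp e x p by move: nxp; rewrite /inner xp negbK.
    by rewrite comp_sym // => /comp_hull.
  (* A child with the same hole as o has fewer than [s] vertices, for otherwise it would have been
     preferred to q. *)
  have [xp|xp] := eqVneq (inner e x p) (inner e o p).
    apply: IH Hx; rewrite ltnNge; apply/negP => szx.
    have := qmin x; rewrite /Q (hull_trans e_sym oq hqx) xp eqxx szx => /(_ isT).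
    by rewrite leqNgt sub.
  have iop : inner e o p.
    case iop: (inner e o p) xp => //; rewrite eqbF_neg negbK => xp.
    by rewrite -iop -qp; apply: hull_inner hqx xp.
  have nxp : ~~ inner e x p by move: xp; rewrite iop eqb_id.
  apply: IHleft Hx => //; apply: leq_ltn_trans szo; apply: subset_leq_card.
  apply/fintype.subsetP => y; rewrite !unfold_in (negPf nxp) /= andbT => xy.
  rewrite (hull_trans e_sym oq) ?(hull_trans e_sym hqx) //= iop /=.
  apply/negP => py; move: nhx; rewrite qp iop /= => /negP; apply.
  have /orP[xp'|//] := hull_meet e_sym xy py.
  have : comp e x p by move: nxp; rewrite /inner xp' negbK.
  by rewrite comp_sym // => /comp_hull.
have jd2 : j.+1 < d.+4 by lia.
have Eop : inner e o p = inner e' o' p' := agree_inner Tj jd2 H.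
have Eqp : inner e q p = inner e' q' p'.
  by apply: (agree_inner Tj _ (agree_sub (J := [:: 0; 2]) q Hq isT)); lia.
have Ecoq : comp e o q = comp e' o' q'.
  by apply: (agree_comp Tj _ (agree_sub (J := [:: 1; 0]) q Hq isT)); lia.
have Ehoq : hull e o q = hull e' o' q'.
  by apply: (agree_hull Tj _ (agree_sub (J := [:: 1; 0]) q Hq isT)); lia.
have [coq|ncoq] := boolP (comp e o q).
  apply: eq_iso node => x.
  - by apply/esym/piece_comp.
  - by move=> _; apply/esym/piece_mark_comp.
  - by apply/esym/piece_comp; rewrite -?Ecoq.
  - by move=> _; apply/esym/piece_mark_comp; rewrite -?Ecoq.
have ioq : inner e o q by rewrite /inner oq.
have ioq' : inner e' o' q' by rewrite /inner -Ehoq -Ecoq oq.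
have qp' : inner e' q' p' = inner e' o' p' by rewrite -Eqp -Eop.
have split_o := fun x => piece_split e_sym x ioq qp.
have split_o' := fun x => piece_split e'_sym x ioq' qp'.
have disj (r : rel T) u v w : inner r u v -> piece r u v w -> ~~ piece r v p w /\ ~~ piece r v p' w.
  by move=> uv /(piece_out uv) nvw; rewrite /piece !negb_and nvw.
have edge_mark (r : rel T) (r_sym : symmetric r) u v c x y :
    inner r u v -> piece r u v x -> piece r v c y -> r x y = piece_mark r u v x.
  move=> uv /(piece_out uv) nvx /andP[vy _].
  by rewrite /piece_mark uv /=; apply: (edge_outE r_sym vy nvx).
have context : iso e (piece e o q) (piece_mark e o q) e' (piece e' o' q') (piece_mark e' o' q').
  apply: IH; last first.
    by apply: agree_mono (agree_sub (J := [:: 3; 2]) q Hb isT); lia.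
  (* The lower part takes at least [s] of fewer than [s + s] vertices, so fewer than [s] remain for
     the context. *)
  have : #|piece e o q| + #|piece e q p| = #|piece e o p|.
    rewrite -cardUI [X in _ + X]eq_card0 ?addn0; last first.
      move=> x; rewrite inE; apply/negP => /andP[ox qx].
      by have [/negP] := disj _ _ _ _ ioq ox.
    by apply: eq_card => x; rewrite inE; apply/esym/split_o.
  lia.
have mark_eq (r : rel T) (r_sym : symmetric r) u v c x : inner r u v ->
    inner r v c = inner r u c -> piece r u v x -> inner r u c ->
    piece_mark r u c x = piece_mark r u v x.
  move=> uv Ec ux uc; rewrite /piece_mark uc uv /=.
  apply: edge_outE; rewrite ?(piece_out uv ux) //.
  by move: uc; rewrite -Ec => /andP[].
have node' : iso e (piece e q p) (piece_mark e o p) e' (piece e' q' p') (piece_mark e' o' p').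
  by apply: eq_iso node => // x _; rewrite /piece_mark ?qp ?qp'.
apply: (eq_iso (A := fun x => piece e o q x || piece e q p x)
  (A' := fun x => piece e' o' q' x || piece e' q' p' x)
  (m := piece_mark e o p) (m' := piece_mark e' o' p')) => //.
apply: (iso_union (n := piece_mark e o q) (n' := piece_mark e' o' q')) => //.
- by move=> x /(disj _ _ _ _ ioq)[].
- by move=> x /(disj _ _ _ _ ioq')[].
- by move=> x y; apply: edge_mark.
- by move=> x y; apply: edge_mark.
- move=> x y ox oy Exy; case iop: (inner e o p); last first.
    by rewrite /piece_mark -Eop iop.
  have iop' : inner e' o' p' by rewrite -Eop.
  by rewrite (mark_eq e e_sym o q p x) // (mark_eq e' e'_sym o' q' p' y).
Qed.

(** A halving applies [determined_step] twice, at four rounds each: once to pieces without a hole,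
    where no child is left over, and then to all pieces. The base depth is the least one above 4 * j
    + 5. At [i = 0] there is nothing to show, because o belongs to its own piece. *)
Lemma determined_piece i o p : #|piece e o p| < 2 ^ i ->
  determined (4 * j + 6 + 8 * i) o p.
Proof.
elim: i o p => [|i IHi] o p.
  by rewrite ltnS leqn0 => /eqP/card0_eq/(_ o)/negP[]; apply: piece_self.
rewrite expnS mul2n -addnn => szo.
have nohole x y : #|piece e x y| < 2 ^ i + 2 ^ i -> ~~ inner e x y ->
    determined (4 * j + 6 + 8 * i).+4 x y.
  move=> szx nxy; apply: determined_step szx _ => //; first lia.
  by rewrite (negPf nxy).
have -> : 4 * j + 6 + 8 * i.+1 = (4 * j + 6 + 8 * i).+4.+4 by lia.
apply: (determined_step (s := 2 ^ i)) => //; first lia.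
  by move=> x y /IHi; apply: determined_mono; lia.
by move=> x _ nxp szx; apply: nohole.
Qed.

End Recursion.

Lemma agree_undirected (T : finType) d (e e' : rel T) :
  1 < d -> symmetric e -> irreflexive e -> @agree T 8 d e e' [::] [::] ->
  symmetric e' /\ irreflexive e'.
Proof.
case: d => [|[|d]] // _ e_sym e_irr /(@agree_sym _ _ _ _ _ _ _) H.
split=> [x y|x]; have [x' Hx] := agree_forth x H isT.
  have [y' Hy] := agree_forth y Hx isT.
  rewrite (agree_atomic (agree_sub (J := [:: 1; 0]) x Hy isT)).
  by rewrite (agree_atomic (agree_sub (J := [:: 0; 1]) x Hy isT)).
by rewrite (agree_atomic (agree_sub (J := [:: 0; 0]) x Hx isT)).
Qed.

Lemma agree_graph_iso (T : finType) j (e e' lt : rel T) :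
  #|T| <= 2 ^ j -> symmetric e -> irreflexive e -> interval_order_of e lt ->
  @agree T 8 (12 * j + 16) e e' [::] [::] ->
  exists f g : T -> T,
    [/\ cancel f g, cancel g f & forall x y, e x y = e' (f x) (f y)].
Proof.
move=> Tj e_sym e_irr ltP H.
have [|e'_sym e'_irr] := agree_undirected _ e_sym e_irr H; first lia.
have [x0 _|T0] := pickP (@predT T); last first.
  by exists id, id; split=> x; have := T0 x.
(* A vertex with a largest hull lies strictly inside no hull, so with this p no piece has a hole. *)
have [p _ pmax] := @arg_maxnP _ x0 predT (fun p => #|hull e p|) isT.
have rootp x : inner e x p = false.
  apply/negP => /andP[xp nxp].
  have := pmax x isT; apply/negP; rewrite -ltnNge; apply: proper_card.
  apply/properP; split.
    by apply/fintype.subsetP => y; rewrite !unfold_in => py; apply: hull_trans py.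
  exists x; rewrite unfold_in; first exact: hullxx.
  by apply: contra nxp => px; apply: hull_antisym.
(* Pieces have at most 2^j < 2^(j+1) vertices, hence [j.+1] halvings. Two more rounds, for marking p
   and for the bijection s, bring the depth to 12 * j + 16. *)
pose d := 4 * j + 6 + 8 * j.+1.
have {}H : @agree T 8 d.+2 e e' [::] [::] by apply: agree_mono H; rewrite /d; lia.
have [p' Hp] := agree_forth p H isT.
have rootp' x : inner e' x p' = false.
  have [x' Hx] := agree_forth x (agree_sym Hp) isT.
  by rewrite (agree_inner Tj _ (agree_sub (J := [:: 0; 1]) x Hx isT)) ?rootp /d //; lia.
have [s [s' [sK s'K sL]]] := agree_move Hp isT.
have wf (r : rel T) v : symmetric r -> (forall x, inner r x v = false) ->
    well_formed r pred0 predT false v.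
  by move=> r_sym rv; split=> // x _; rewrite rv.
have top_inv x : top e pred0 predT false p x = top e' pred0 predT false p' (s x).
  have dE : d.-1.+1 = d by rewrite /d; lia.
  have := sL x; rewrite -dE /top /= => Hx; apply: (agree_forall Hx isT) => w w' Hw /=.
  rewrite (agree_inner Tj _ (agree_sub (J := [:: 0; 1]) x Hw isT)) //; rewrite /d; lia.
(* At the outermost level [O] is empty and the blocks are the hulls of the roots of the forest, with
   no edges between them. *)
have [] := glue (wf e p e_sym rootp) (wf e' p' e'_sym rootp')
  (lab := fun x => #|comp e x|) (lab' := fun x => #|comp e' x|) e_irr e'_irr
  _ _ _ _ sK s'K top_inv _ _.
- by move=> x y _ _ xy; apply: eq_card => z; apply: (comp_eql e_sym z xy).
- by move=> x y _ _ xy; apply: eq_card => z; apply: (comp_eql e'_sym z xy).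
- by [].
- by [].
- move=> x _; apply: (agree_card_comp Tj _ (agree_sub (J := [:: 0]) x (sL x) isT)); rewrite /d; lia.
- move=> x _ _; apply: (determined_piece Tj e_sym e'_sym e_irr e'_irr ltP _ (sL x)).
  apply: (leq_ltn_trans (max_card _)); rewrite expnS mul2n -addnn.
  by apply: leq_ltn_trans Tj _; rewrite -[X in X < _]addn0 ltn_add2l expn_gt0.
move=> f [g [fA gA fe _]]; exists f, g; split=> [x|x|x y].
- by case: (fA x isT).
- by case: (gA x isT).
- exact: fe.
Qed.

(** * Describing sentences *)

Lemma isomorphic_sym (G H : graph) : isomorphic G H -> isomorphic H G.
Proof.
case=> h [g hg gh] hE; exists g; first by exists h.
by move=> x y; rewrite hE !gh.
Qed.

Lemma isomorphic_trans (G H K : graph) :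
  isomorphic G H -> isomorphic H K -> isomorphic G K.
Proof.
case=> h hB hE [g gB gE]; exists (g \o h); first exact: bij_comp.
by move=> x y; rewrite hE gE.
Qed.

Lemma card_eq_bijective (T U : Type) : [set: T] #= [set: U] ->
  exists f : T -> U, bijective f.
Proof.
case/card_bijP => f [g fg gf].
pose i (V : Type) (x : V) : set_type [set: V] := SigSub (mem_setT x).
have iK V (x : set_type [set: V]) : i V (set_val x) = x by apply: val_inj.
exists (fun x => set_val (f (i T x))), (fun y => set_val (g (i U y))) => x.
  by rewrite iK fg.
by rewrite iK gf.
Qed.

Lemma has_order_bijective (G : graph) n : has_order G n -> exists h : G -> 'I_n, bijective h.
Proof. by move=> /card_eq_trans/(_ card_II)/card_eq_bijective. Qed.

Lemma has_order_graph_of (G : graph) n : has_order G n ->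
  exists e : rel 'I_n, isomorphic G (graph_of e).
Proof.
case/has_order_bijective => h [g hg gh].
exists (fun x y => `[< edge (g x) (g y) >]); exists h; first by exists g.
by move=> x y; rewrite /graph_of /= asboolE !hg.
Qed.

Definition order_sentence k (n : nat) : formula k.+1 :=
  FAnd (FExGe n ord0 (FEq ord0 ord0)) (FNot (FExGe n.+1 ord0 (FEq ord0 ord0))).

Lemma sentence_order k n : sentence (order_sentence k n).
Proof. by apply/setP => i; rewrite !inE; case: (i == ord0). Qed.

Lemma qdepth_order k n : qdepth (order_sentence k n) = 1.
Proof. by []. Qed.

Lemma models_order k n (G : graph) : models G (order_sentence k n) <-> has_order G n.
Proof.
have E m : sat (fun=> None : option G) (FExGe m (ord0 : 'I_k.+1) (FEq ord0 ord0))
    = (`I_m #<= [set: G]).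
  rewrite /=; congr (is_true (_ #<= _)); apply/seteqP; split=> // a _ /=.
  by exists a.
rewrite /models /has_order.
have -> : sat (fun=> None : option G) (order_sentence k n)
    = ((`I_n #<= [set: G]) /\ ~ (`I_n.+1 #<= [set: G])) by rewrite -!E.
split=> [[le nle]|oG]; last by rewrite !(card_le_eqr oG) !card_le_II ltnn.
have fin : finite_set [set: G].
  apply: contrapT => /infiniteP inf; apply: nle; apply: card_le_trans inf.
  exact: card_leT.
have [m mG] := (finite_setP _).1 fin.
move: le nle; rewrite !(card_le_eqr mG) !card_le_II => nm /negP; rewrite -leqNgt => mn.
by rewrite (_ : n = m) //; apply/eqP; rewrite eqn_leq nm mn.
Qed.

Lemma interval_order_of_intervals (T : finType) (e : rel T) (A : T -> set int) :
  injective A -> (forall x, is_interval (A x)) ->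
  (forall x y, e x y <-> x <> y /\ A x `&` A y !=set0) ->
  exists lt, interval_order_of e lt.
Proof.
move=> A_inj A_itv eE.
(* By injectivity at most one interval is empty, and it is placed before all others. Requiring [A y]
   to be nonempty keeps it from preceding itself. *)
pose lt x y := `[< A y !=set0 /\ forall a b, A x a -> A y b -> (a < b)%R >].
exists lt; split=> [x|x y x' y' /asboolP[y0 xy] /asboolP[y'0 xy']|x y].
- by apply/asboolPn => -[[a Aa] /(_ a a Aa Aa)]; rewrite Order.POrderTheory.ltxx.
- apply/orP; have [l|nl] := boolP (lt x y'); [by left|right]; apply/asboolP; split=> // a' b A'a' Bb.
  move/asboolPn: nl => /not_andP[//|/existsNP[a /existsNP[b' /not_implyP[Aa /not_implyP[B'b' nab']]]]].
  have := xy a b Aa Bb; have := xy' a' b' A'a' B'b'; move/negP: nab'; lia.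
- apply/idP/orP => [|[]/asboolP[[b Bb] lt_xy]]; last first.
  + apply/norP; split; first by apply/eqP => xy; subst y; have := lt_xy _ _ Bb Bb; lia.
    by apply/negP => /eE[_ [c [Ac Bc]]]; have := lt_xy _ _ Bc Ac; lia.
  + apply/norP; split; first by apply/eqP => xy; subst y; have := lt_xy _ _ Bb Bb; lia.
    by apply/negP => /eE[_ [c [Ac Bc]]]; have := lt_xy _ _ Ac Bc; lia.
  rewrite /far /cadj negb_or => /andP[/eqP nxy /negP ne].
  have disj c : A x c -> A y c -> False.
    by move=> Ac Bc; apply: ne; apply/eE; split=> //; exists c.
  have [Ax0|/set0P[a0 Aa0]] := eqVneq (A x) set0.
    left; apply/asboolP; split; last by move=> a b; rewrite Ax0.
    by apply/set0P/eqP => Ay0; apply: nxy; apply: A_inj; rewrite Ax0 Ay0.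
  have [Ay0|/set0P[b0 Bb0]] := eqVneq (A y) set0.
    by right; apply/asboolP; split; [exists a0|move=> a b; rewrite Ay0].
  (* If some point b of the second interval were at most a point a of the first, convexity would put
     a1 or b into both. *)
  have key x1 y1 a1 b1 : A x1 a1 -> A y1 b1 -> (forall c, A x1 c -> A y1 c -> False) ->
      (a1 < b1)%R -> lt x1 y1.
    move=> Aa1 Bb1 dj lt1; apply/asboolP; split=> [|a b Aa Bb]; first by exists b1.
    rewrite Order.TotalTheory.ltNge; apply/negP => ba.
    have [ba1|a1b] : (b <= a1)%R \/ (a1 <= b)%R by lia.
      by apply: (dj a1) => //; apply: (A_itv y1 b b1); rewrite // ba1 /=; lia.
    by apply: (dj b) => //; apply: (A_itv x1 a1 a); rewrite // a1b ba.
  have [ab|ba] : (a0 < b0)%R \/ (b0 < a0)%R.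
    have : a0 <> b0 by move=> ab; apply: (disj a0) => //; rewrite ab.
    lia.
  - by left; apply: key ab.
  - by right; apply: (key y x b0 a0) => // c; move=> /[swap]; apply: disj.
Qed.

Lemma interval_graph_order (G : graph) n (e : rel 'I_n) :
  interval_graph G -> isomorphic G (graph_of e) ->
  [/\ symmetric e, irreflexive e & exists lt, interval_order_of e lt].
Proof.
move=> [[G_sym G_irr] [I [_ I_itv [h [h' hK h'K] hE]]]] [g [g' gK g'K] gE].
have eE x y : e x y <-> edge (g' x) (g' y) by rewrite gE !g'K.
split.
- by move=> x y; apply/idP/idP => /eE/G_sym/eE.
- by move=> x; apply/negP => /eE/G_irr.
apply: (interval_order_of_intervals (A := fun x => set_val (h (g' x)))).
- by move=> x y /val_inj/(can_inj hK)/(can_inj g'K).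
- by move=> x; apply: I_itv; apply: set_valP.
- move=> x y; rewrite eE hE /=; split=> -[ne ?]; split=> //.
    by move=> xy; apply: ne; rewrite xy.
  by move=> /(can_inj hK)/(can_inj g'K).
Qed.

(** The isolating formula of one assignment in the first graph is taken against all finitely many
    assignments in the second, so even its existential closure fails there. *)
Lemma separating_sentence (T : finType) k d (e e' : rel T) (x0 : T) :
  ~ @agree T k.+1 d e e' [::] [::] -> exists phi : formula k.+1,
    [/\ sentence phi, qdepth phi <= k.+1 + d, models (graph_of e) phi
      & ~ models (graph_of e') phi].
Proof.
move=> nL; pose s0 : 'I_k.+1 -> T := fun=> x0.
have [phi [phid s0phi phiP]] := isolating_formula
  (fun s : {ffun 'I_k.+1 -> T} => (e', fun i => s i)) d (e, s0) ord0.
exists (ex_closure phi); split.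
- exact: sentence_ex_closure.
- by rewrite qdepth_ex_closure leq_add2l.
- by apply/sat_ex_closure; exists s0.
- move=> /sat_ex_closure[s sphi]; apply: nL; exists s0, s, [::]; split=> //.
  have sE : (fun i => [ffun i => s i] i) = s by apply/funext => i; rewrite ffunE.
  by have := phiP [ffun i => s i]; rewrite sE; apply.
Qed.

Lemma models_isomorphic k (phi : formula k) (G H : graph) :
  isomorphic G H -> models G phi <-> models H phi.
Proof. by case=> h hB hE; apply: (sat_isomorphic hB hE). Qed.

(** Once the order is fixed, which also excludes infinite structures, only finitely many relations
    on ['I_n] remain, and each contributes one conjunct. The closure of eight variables turns 12 * j
    + 16 into 12 * j + 24. *)
Lemma describing_sentence n (G : graph) :
  interval_graph G -> has_order G n -> exists phi : formula 8,
    [/\ sentence phi, qdepth phi <= 12 * (trunc_log 2 n).+1 + 24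
      & forall H : graph, models H phi <-> isomorphic H G].
Proof.
move=> Gint Gn; have [e Ge] := has_order_graph_of Gn.
have [e_sym e_irr [lt ltP]] := interval_graph_order Gint Ge.
pose j := (trunc_log 2 n).+1.
have nj : #|'I_n| <= 2 ^ j by rewrite card_ord ltnW // trunc_log_ltn.
pose rel_of (r : {ffun 'I_n * 'I_n -> bool}) : rel 'I_n := fun x y => r (x, y).
have /choice[psi psiP] : forall r, exists phi : formula 8,
    [/\ sentence phi, qdepth phi <= 12 * j + 24, models (graph_of e) phi
      & models (graph_of (rel_of r)) phi -> isomorphic (graph_of (rel_of r)) (graph_of e)].
  move=> r; have [iso_r|niso] := pselect (isomorphic (graph_of (rel_of r)) (graph_of e)).
    exists (order_sentence 7 n); split=> //.
    - exact: sentence_order.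
    - by rewrite models_order /has_order card_eq_sym; apply: card_II.
  (* The game needs a vertex for its starting assignment; for [n = 0] the identity is already an
     isomorphism. *)
  have [x0 _|no] := pickP (@predT 'I_n); last first.
    case: niso; exists id => [|x]; first by exists id.
    by have := no x.
  have nL : ~ @agree 'I_n 8 (12 * j + 16) e (rel_of r) [::] [::].
    move=> /(agree_graph_iso nj e_sym e_irr ltP)[f [g [fg gf fe]]].
    apply/niso/isomorphic_sym; exists f; first by exists g.
    by move=> x y; rewrite /graph_of /= fe.
  have [phi [phi0 phid ephi rphi]] := separating_sentence x0 nL.
  by exists phi; split=> //; lia.
exists (conj_seq (order_sentence 7 n) (map psi (enum {ffun 'I_n * 'I_n -> bool}))).
have inP phi : List.In phi (map psi (enum {ffun 'I_n * 'I_n -> bool})) -> exists r, phi = psi r.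
  by elim: (enum _) => //= r s IHs [<-|/IHs//]; exists r.
have psi_in r : List.In (psi r) (map psi (enum {ffun 'I_n * 'I_n -> bool})).
  have : r \in enum {ffun 'I_n * 'I_n -> bool} by rewrite mem_enum.
  elim: (enum _) => //= r' s IHs; rewrite inE => /orP[/eqP->|/IHs]; first by left.
  by right.
split.
- apply: sentence_conj_seq; first exact: sentence_order.
  by move=> _ /inP[r ->]; case: (psiP r).
- apply: qdepth_conj_seq; first by rewrite qdepth_order; lia.
  by move=> _ /inP[r ->]; case: (psiP r).
- move=> H; split=> [/sat_conj_seq[/models_order Hn Hpsi]|HG].
    have [e2 He2] := has_order_graph_of Hn.
    pose r : {ffun 'I_n * 'I_n -> bool} := [ffun w => e2 w.1 w.2].
    have rE : rel_of r = e2 by apply/funext => x; apply/funext => y; rewrite /rel_of ffunE.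
    apply: (isomorphic_trans He2); apply: isomorphic_trans (isomorphic_sym Ge).
    have [_ _ _] := psiP r; rewrite rE; apply.
    by apply/(models_isomorphic _ He2); apply: Hpsi.
  apply/sat_conj_seq; split.
    apply/models_order; case: HG => h [h' hK h'K] _.
    apply: card_eq_trans Gn; rewrite card_eq_sym.
    have -> : [set: G] = h @` [set: H].
      by apply/seteqP; split=> // y _; exists (h' y).
    by apply: inj_card_eq => x y _ _; apply: (can_inj hK).
  move=> _ /inP[r ->]; apply/(models_isomorphic _ (isomorphic_trans HG Ge)).
  by case: (psiP r).
Qed.


(** * Growth of the quantifier depth *)

Import Order.TTheory Num.Theory GRing.Theory.
Local Open Scope ring_scope.

Lemma trunc_log_bigO (R : realType) (a b : nat) :
  (fun n : nat => (a * (trunc_log 2 n).+1 + b)%N%:R : R) =O_\oo (fun n : nat => ln (n%:R : R)).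
Proof.
(* From [n = 2] on the truncated logarithm t is at least 1, so a * (t + 1) + b is at most (a + a +
   b) * t; the successor keeps the constant positive. *)
apply/eqO_exP; exists ((a + a + b)%N.+1%:R / ln 2).
  by rewrite divr_gt0 // ln_gt0 // ltr1n.
exists 2%N => // n /= n2.
have n0 : (0 < n)%N by apply: leq_trans n2.
have t1 : (1 <= trunc_log 2 n)%N by apply: trunc_log_max.
have tln : (trunc_log 2 n)%:R * ln 2 <= ln (n%:R : R).
  have := trunc_logP (isT : 1 < 2)%N n0; set t := trunc_log 2 n => tn.
  rewrite mulrC mulr_natr -lnXn // -natrX ler_ln ?posrE ?ltr0n ?expn_gt0 //.
  by rewrite ler_nat.
rewrite normr_nat ger0_norm; last by rewrite ln_ge0 // ler1n.
apply: (@le_trans _ _ ((a + a + b)%N.+1%:R * (trunc_log 2 n)%:R)).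
  rewrite -natrM ler_nat; move: (trunc_log 2 n) t1 => t; nia.
rewrite -mulrA ler_pM2l ?ltr0n // mulrC ler_pdivlMr //.
by rewrite ln_gt0 // ltr1n.
Qed.

Theorem theorem2 (R : realType) :
  exists (k : nat) (f : nat -> nat),
    ((fun n : nat => (f n)%:R : R) =O_\oo (fun n : nat => ln (n%:R : R))) /\
    forall (n : nat) (G : graph), interval_graph G -> has_order G n ->
      exists phi : formula k,
        [/\ sentence phi, (qdepth phi <= f n)%N
          & forall H : graph, models H phi <-> isomorphic H G].
Proof.
(* Eight variables accommodate the longest lists of the game, which have six vertices: two far pairs
   and the midpoint pair in the path doubling for [orient]. *)
exists 8%N, (fun n => 12 * (trunc_log 2 n).+1 + 24)%N.
by split; [exact: trunc_log_bigO|exact: describing_sentence].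
Qed.
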